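(* As $k\to\infty$, the rank distribution of the infinite random recursive tree decays as $$r_k=\exp\left[-2k\log k+2(1-\log 2)k+O(\log k)\right].$$
   Context: All logarithms are natural. A random recursive tree (RRT) $G_n$ of size $n$ is a random labeled tree on the node set $\{1,\dots,n\}$ built as follows: start with node $1$; for $t=2,\dots,n$, node $t$ is attached by an edge to one node chosen uniformly at random from the existing nodes $\{1,\dots,t-1\}$, independently of previous choices. A leaf is a node of degree $1$ (the root, node $1$, is also a leaf if it has degree $1$). The rank of a node is its graph distance to the closest leaf, so leaves have rank $0$; in the one-node tree the single node has rank $0$. Let $R_{n,k}$ be the number of nodes of rank $k$ in $G_n$, let $r_k(n)=\mathbb E[R_{n,k}/n]$, and let $r_k=\lim_{n\to\infty}r_k(n)$ (these limits exist). *)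

(* Defs.v *)
From HB Require Import structures.
From mathcomp Require Import all_boot all_order all_algebra.
From mathcomp Require Import all_classical all_reals all_analysis.

Set Implicit Arguments.
Unset Strict Implicit.
Unset Printing Implicit Defensive.

Import Order.TTheory GRing.Theory Num.Theory.
Import numFieldNormedType.Exports.

Local Open Scope ring_scope.

Section Graph.
Variables (T : finType) (e : rel T).

Definition degree (x : T) : nat := #|[set y | e x y]|.

Definition leaf (x : T) : bool := degree x == 1%N.

Definition has_walk (x y : T) (d : nat) : bool :=
  [exists s : d.-tuple T, path e x s && (last x s == y)].

(* A shortest walk visits each vertex at most once, so its length is below
   #|T|; the value is #|T| when y is not reachable from x. *)
Definition gdist (x y : T) : nat := find (has_walk x y) (iota 0 #|T|).

(* The bound #|T| is the neutral element of the minimum: in a connected graph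
   every distance is below it. A graph without leaves, such as the one-vertex
   graph, gets rank 0 everywhere. *)
Definition rank (x : T) : nat :=
  if [exists l, leaf l]
  then \big[minn/#|T|]_(l | leaf l) gdist x l
  else 0%N.

End Graph.

(* The node labelled t in {1, ..., n} is the element of 'I_n of value t - 1, so
   the node of value i > 0 picks its parent among the i nodes of smaller value.
   A tree on these nodes is given by its parent function; the root, of value 0,
   has no parent, and its image (0 with probability 1) gives no edge. *)
Definition tree_edge (n : nat) (p : {ffun 'I_n -> 'I_n}) : rel 'I_n :=
  [rel i j : 'I_n | (0 < i)%N && (p i == j) || (0 < j)%N && (p j == i)].

Section RandomRecursiveTree.
Variable R : realType.

Definition attach_prob (n : nat) (i j : 'I_n) : R :=
  if (0 < i)%N then (if (j < i)%N then i%:R^-1 else 0)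
  else (j == i)%:R.

(* The product over the nodes expresses that the choices are independent. *)
Definition rrt_prob (n : nat) (p : {ffun 'I_n -> 'I_n}) : R :=
  \prod_(i < n) attach_prob i (p i).

Definition rrt_expectation (n : nat) (X : {ffun 'I_n -> 'I_n} -> R) : R :=
  \sum_p rrt_prob p * X p.

Definition rank_count (n k : nat) (p : {ffun 'I_n -> 'I_n}) : nat :=
  #|[set v | rank (tree_edge p) v == k]|.

Definition rank_mean (k n : nat) : R :=
  rrt_expectation (fun p : {ffun 'I_n -> 'I_n} => (rank_count k p)%:R / n%:R).

Definition rank_limit (k : nat) : R :=
  limn (fun n => rank_mean k n).

End RandomRecursiveTree.

(* Main.v *)
Require Import Defs.
From HB Require Import structures.
From mathcomp Require Import all_boot all_order all_algebra.
From mathcomp Require Import all_classical all_reals all_analysis.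
From mathcomp Require Import zify ring lra.

(** The point is that r_k equals 1 / (2k)! up to a factor polynomial in k; the
    formula is then Stirling's, as (2k)! is exp (2k log (2k) - 2k + O(log k)).

    Decomposition. Cutting the edge between the root and its oldest child
    splits a recursive tree into two independent recursive trees, whose sizes
    are uniform given their sum ([mean_split]). So if f factors as g times h
    along this cut, the series F(u) = sum_n E_n[f] u^n satisfies F' = G H,
    where E_n is the expectation for n + 1 nodes. In the same way, the sum of f
    over the fringe subtrees (a node with all its descendants) of all non-root
    nodes has expectation (n + 1) sum_(m < n) E_m[f] / ((m + 1)(m + 2)), which
    divided by n + 1 is nondecreasing in n if f >= 0 ([mean_fringe_sum]).

    Locality. Let v have depth greater than d, and let w be its d-th ancestor.
    If v has rank at least k, then no childless node of the fringe subtree of w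
    is at distance less than k from v. The converse holds if d >= k - 1, since
    it then takes at least k steps to leave that subtree. The nodes of depth at
    most d are o(n) in number ([shallow_mean_cvg]). Hence the mean proportion of
    nodes of rank at least k converges, and so does that of nodes of rank k
    ([rank_mean_cvg]).

    Lower bound. If a fringe subtree is a path with 2k nodes, its node at depth
    k - 1 is at distance k from the bottom of the path and at distance k from
    the parent of the top, so its rank is k. A recursive tree with 2k nodes is
    such a path with probability 1 / (2k - 1)!, which yields the density
    1 / (2k + 1)! of these fringe subtrees ([rank_limit_ge]).

    Upper bound. Let P_j(u) = sum_n Prob_n[every childless node has depth at
    least j] u^(n+1) / (n + 1). Then P_(j+1)' = exp P_j - 1, because the
    branches at the root form a set of trees counted by P_j. As P_j has no term
    of degree below j + 1, integrating from 0 to 1 divides by at least j + 2: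
    once P_j(1) is small, P_j(1) decays like 1 / (j + 1)!. Likewise,
    replacing the root v of a tree counted by P_k by its parent, then its
    grandparent, and so on, multiplies the series by some exp P_j and
    integrates it, where the degrees run through k + 1, k + 2, ... . This
    is used up to the ancestor number k - 5, which is enough for the bound
    10 k^2 / (2k - 4)! ([rank_limit_le]); the series P_0, P_1, P_2 that the
    last few ancestors would involve diverge at 1, whereas P_3(1) <= 5/8 and
    P_4(1) <= 1/3. The proofs use only partial sums of the series at u = 1, and
    the bound 1 / (1 - P) in the place of exp P ([branches_sum_le]). *)

Set Implicit Arguments.
Unset Strict Implicit.
Unset Printing Implicit Defensive.

Import Order.TTheory GRing.Theory Num.Theory.
Import numFieldNormedType.Exports.

(** * Trees as iterated grafts *)

(** Graft l r is the rooted tree obtained by hanging l below the root of r, as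
    the subtree of the oldest child. With this encoding the nodes of a rooted
    tree are the terminal nodes of a binary tree, attaching a new node replaces
    one of them, and the oldest branch is split off by a single case analysis. *)
Inductive tree (A : Type) := Node of A | Graft of tree A & tree A.

Section Unlabelled.
Variable A : Type.
Implicit Types t l r : tree A.

Definition is_node t := if t is Node _ then true else false.

Fixpoint tsize t := if t is Graft l r then tsize l + tsize r else 1.

(** Least depth of a childless node, the only node of a one-node tree being
    one. The root of r ceases to be childless when l is grafted onto it, whence
    the case distinction. *)
Fixpoint leaf_depth t :=
  if t is Graft l r then
    if is_node r then (leaf_depth l).+1 else minn (leaf_depth l).+1 (leaf_depth r)
  else 0.

(** The condition is that j <= leaf_depth b for each branch b at the root:
    branches start at depth 1, and a single node has none. *)
Definition branches_deep j t := is_node t || (j < leaf_depth t).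

(** Number of nodes v at depth d such that every childless node is at distance
    at least k from v. Seen from v, the root of t is at distance d and the
    roots of the branches that avoid v are at distance d + 1. So these branches
    must have leaf_depth at least k - (d + 1), and v must be far from the
    childless nodes of the branch that contains it. *)
Fixpoint far_count k t d : nat :=
  match t, d with
  | Graft l r, d'.+1 =>
      far_count k l d' * branches_deep (k - d.+1) r
      + (k - d.+1 <= leaf_depth l) * far_count k r d
  | _, 0 => k <= leaf_depth t
  | Node _, _ => 0
  end.

Fixpoint depth_count t d : nat :=
  match t with
  | Node _ => 1
  | Graft l r => (if d is d'.+1 then depth_count l d' else 0) + depth_count r d
  end.

(** The path has n edges and is rooted at one of its ends. *)
Fixpoint is_path n t : bool :=
  match n, t with
  | 0, Node _ => true
  | n'.+1, Graft l r => is_path n' l && is_node r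
  | _, _ => false
  end.

(** Sum of f over the fringe subtrees of all nodes but the root. *)
Fixpoint fringe_sum (f : tree A -> nat) t : nat :=
  if t is Graft l r then f l + fringe_sum f l + fringe_sum f r else 0.

Lemma eq_fringe_sum f g t : f =1 g -> fringe_sum f t = fringe_sum g t.
Proof. by move=> E; elim: t => //= l -> r ->; rewrite E. Qed.

Lemma tsize_gt0 t : 0 < tsize t.
Proof. by elim: t => //= l Hl r Hr; lia. Qed.

Lemma leaf_depth_ltsize t : leaf_depth t < tsize t.
Proof. by elim: t => //= l Hl r Hr; have := tsize_gt0 r; case: ifP => _; lia. Qed.

Lemma branches_deep_graft j l r :
  branches_deep j (Graft l r) = (j <= leaf_depth l) && branches_deep j r.
Proof. by rewrite /branches_deep /=; case: (is_node r); rewrite ?andbT //; lia. Qed.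

(** A node at depth d has at least k generations of descendants if it is far
    from the childless nodes, so the tree has a path with d + k edges. *)
Lemma far_count_size k t d : tsize t < k + d.+1 -> far_count k t d = 0.
Proof.
elim: t d => [a|l IHl r IHr] [|d] //=.
- by case: k => //; lia.
- move=> H; apply/eqP; rewrite eqb0 -ltnNge.
  by have := leaf_depth_ltsize (Graft l r) => /=; lia.
- move=> H; have := tsize_gt0 l; have := tsize_gt0 r => Hr Hl.
  by rewrite IHl ?IHr ?muln0 //; lia.
Qed.
End Unlabelled.

Fixpoint unlabel (A : Type) (t : tree A) : tree unit :=
  match t with Node _ => Node tt | Graft l r => Graft (unlabel l) (unlabel r) end.

Section Unlabel.
Variable A : Type.
Implicit Types t : tree A.

Lemma is_node_unlabel t : is_node (unlabel t) = is_node t.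
Proof. by case: t. Qed.

Lemma leaf_depth_unlabel t : leaf_depth (unlabel t) = leaf_depth t.
Proof. by elim: t => //= l -> r ->; rewrite is_node_unlabel. Qed.

Lemma far_count_unlabel k t d : far_count k (unlabel t) d = far_count k t d.
Proof.
elim: t d => [a|l IHl r IHr] [|d] //=.
  by rewrite !leaf_depth_unlabel is_node_unlabel.
by rewrite IHl IHr /branches_deep is_node_unlabel !leaf_depth_unlabel.
Qed.

Lemma depth_count_unlabel t d : depth_count (unlabel t) d = depth_count t d.
Proof. by elim: t d => [a|l IHl r IHr] [|d] //=; rewrite IHr ?IHl. Qed.

Lemma is_path_unlabel n t : is_path n (unlabel t) = is_path n t.
Proof. by elim: t n => [a|l IHl r IHr] [|n] //=; rewrite IHl is_node_unlabel. Qed.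

Lemma fringe_sum_unlabel (f : tree unit -> nat) t :
  fringe_sum f (unlabel t) = fringe_sum (fun u => f (unlabel u)) t.
Proof. by elim: t => //= l -> r ->. Qed.
End Unlabel.

Section Grow.
Implicit Types t l r : tree unit.

Fixpoint grow (t : tree unit) : seq (tree unit) :=
  match t with
  | Node _ => [:: Graft (Node tt) (Node tt)]
  | Graft l r => [seq Graft l' r | l' <- grow l] ++ [seq Graft l r' | r' <- grow r]
  end.

Lemma size_grow t : size (grow t) = tsize t.
Proof. by elim: t => //= l Hl r Hr; rewrite size_cat !size_map Hl Hr. Qed.

Lemma sum_grow_graft (F : tree unit -> nat) l r :
  \sum_(t <- grow (Graft l r)) F t =
  \sum_(l' <- grow l) F (Graft l' r) + \sum_(r' <- grow r) F (Graft l r').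
Proof. by rewrite /= big_cat !big_map. Qed.

(** Each attachment keeps the old nodes, and it creates a node of depth at most
    d when it is made at a node of depth less than d. *)
Lemma sum_depth_count t d : \sum_(t' <- grow t) depth_count t' d =
  tsize t * depth_count t d + (if d is d'.+1 then depth_count t d' else 0).
Proof.
elim: t d => [a|l IHl r IHr] d; first by rewrite /= big_seq1; case: d.
rewrite sum_grow_graft /= !big_split /= IHr !big_const_seq !count_predT !iter_addn_0 !size_grow.
by case: d => [|d]; rewrite ?IHl ?big_const_seq ?iter_addn_0 ?count_predT; [lia|case: d => [|d]; lia].
Qed.

End Grow.

Local Notation ltree := (tree nat).

(** * Trees with labelled nodes *)

Section Labelled.
Implicit Types T l r : ltree.

Fixpoint root_label T := match T with Node a => a | Graft _ r => root_label r end.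

Fixpoint labels T : seq nat :=
  match T with Node a => [:: a] | Graft l r => labels l ++ labels r end.

Fixpoint depth T x : nat :=
  match T with
  | Node _ => 0
  | Graft l r => if x \in labels l then (depth l x).+1 else depth r x
  end.

Fixpoint tree_dist T x y : nat :=
  match T with
  | Node _ => 0
  | Graft l r =>
      if x \in labels l then
        if y \in labels l then tree_dist l x y else (depth l x).+1 + depth r y
      else
        if y \in labels l then (depth l y).+1 + depth r x else tree_dist r x y
  end.

Fixpoint parent_of T x y : bool :=
  match T with
  | Node _ => false
  | Graft l r => [|| parent_of l x y, parent_of r x y | (x == root_label l) && (y == root_label r)]
  end.

Fixpoint childless T x : bool :=
  match T with
  | Node a => x == a
  | Graft l r => if x \in labels l then childless l x else childless r x && (x != root_label r)
  end.

Lemma root_labels T : root_label T \in labels T.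
Proof. by elim: T => /= [a|l _ r Hr]; rewrite ?inE // mem_cat Hr orbT. Qed.

Lemma childless_labels T x : childless T x -> x \in labels T.
Proof.
elim: T => /= [a|l IHl r IHr]; first by rewrite inE.
by rewrite mem_cat; case: ifP => //= _ /andP[/IHr].
Qed.

Lemma parent_of_labels T x y : parent_of T x y -> (x \in labels T) && (y \in labels T).
Proof.
elim: T => //= l IHl r IHr; rewrite !mem_cat.
case/or3P=> [/IHl/andP[-> ->]|/IHr/andP[-> ->]|/andP[/eqP-> /eqP->]] //.
  by rewrite !orbT.
by rewrite !root_labels orbT.
Qed.

Lemma uniq_graft l r : uniq (labels (Graft l r)) ->
  [/\ uniq (labels l), uniq (labels r) & forall x, x \in labels r -> (x \in labels l) = false].
Proof.
rewrite /= cat_uniq => /and3P[-> /hasPn H ->]; split=> // x /H.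
by move=> Hx; apply/negbTE.
Qed.

Lemma depth_root T : uniq (labels T) -> depth T (root_label T) = 0.
Proof.
elim: T => //= l IHl r IHr /(@uniq_graft l r)[Ul Ur D].
by rewrite (D _ (root_labels r)) IHr.
Qed.

Lemma dist_rootr T x : uniq (labels T) -> tree_dist T x (root_label T) = depth T x.
Proof.
elim: T => //= l IHl r IHr /(@uniq_graft l r)[Ul Ur D].
by rewrite (D _ (root_labels r)) depth_root // IHr // addn0.
Qed.

Lemma tree_distC T x y : tree_dist T x y = tree_dist T y x.
Proof. by elim: T => //= l IHl r IHr; case: ifP; case: ifP. Qed.

Lemma tree_distxx T x : tree_dist T x x = 0.
Proof. by elim: T => //= l IHl r IHr; case: (x \in labels l). Qed.

Lemma dist_rootl T x : uniq (labels T) -> tree_dist T (root_label T) x = depth T x.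
Proof. by move=> U; rewrite tree_distC dist_rootr. Qed.

Lemma depth_gt0 T x : uniq (labels T) -> x \in labels T -> (0 < depth T x) = (x != root_label T).
Proof.
elim: T => /= [a _|l IHl r IHr /(@uniq_graft l r)[Ul Ur D]].
  by rewrite inE => ->.
rewrite mem_cat; case: ifP => /= [xl _|_ /IHr->//].
by apply/esym/eqP => E; move: xl; rewrite E D ?root_labels.
Qed.

Lemma childless_root T : uniq (labels T) -> childless T (root_label T) = is_node T.
Proof.
case: T => /= [a|l r /(@uniq_graft l r)[Ul Ur D]]; first by rewrite eqxx.
by rewrite (D _ (root_labels r)) eqxx andbF.
Qed.

Lemma childlessE T x : uniq (labels T) ->
  reflect (x \in labels T /\ forall y, ~~ parent_of T y x) (childless T x).
Proof.
move=> U; apply: (iffP idP).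
  elim: T U => /= [a _|l IHl r IHr /(@uniq_graft l r)[Ul Ur D]].
    by rewrite inE => ->.
  rewrite mem_cat; case: ifP => [xl /(IHl Ul)[_ H]|xl /andP[/(IHr Ur)[xr H] xR]].
    split=> // y; rewrite (negbTE (H y)) /=; apply/norP; split.
      by apply/negP => /parent_of_labels/andP[_ /D]; rewrite xl.
    by apply/negP => /andP[_ /eqP E]; move: xl; rewrite E D ?root_labels.
  rewrite xr; split=> // y; rewrite (negbTE (H y)) (negbTE xR) andbF /=.
  by rewrite orbF; apply/negP => /parent_of_labels/andP[_]; rewrite xl.
elim: T U => /= [a _|l IHl r IHr /(@uniq_graft l r)[Ul Ur D]].
  by rewrite inE => -[].
rewrite mem_cat => -[Hx H]; case: ifP => xl.
  by apply: IHl => //; split=> // y; have := H y; case: parent_of.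
move: Hx; rewrite xl /= => xr; apply/andP; split.
  by apply: IHr => //; split=> // y; have := H y; case: (parent_of r); rewrite ?orbT.
by apply/eqP => E; have := H (root_label l); rewrite E !eqxx !orbT.
Qed.

Definition tree_adj T x y := parent_of T x y || parent_of T y x.

Lemma adj_labels T x y : tree_adj T x y -> (x \in labels T) && (y \in labels T).
Proof. by case/orP => /parent_of_labels/andP[-> ->]. Qed.

Lemma adj_graft l r x y :
  tree_adj (Graft l r) x y = [|| tree_adj l x y, tree_adj r x y, (x == root_label l) && (y == root_label r)
     | (y == root_label l) && (x == root_label r)].
Proof.
rewrite /tree_adj /=; case: (parent_of l x y); case: (parent_of l y x);
  case: (parent_of r x y); case: (parent_of r y x); rewrite /= ?orbT //.
Qed.

(** Together with [dist_walk], this identifies [tree_dist] with the distance in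
    the graph of the tree. *)
Lemma dist_adj T v y z : uniq (labels T) -> v \in labels T -> tree_adj T y z ->
  tree_dist T v z <= (tree_dist T v y).+1.
Proof.
elim: T v y z => //= l IHl r IHr v y z /(@uniq_graft l r)[Ul Ur D].
have dl y' z' : tree_adj l y' z' -> depth l z' <= (depth l y').+1.
  by rewrite -!dist_rootl //; apply: IHl => //; apply: root_labels.
have dr y' z' : tree_adj r y' z' -> depth r z' <= (depth r y').+1.
  by rewrite -!dist_rootl //; apply: IHr => //; apply: root_labels.
rewrite mem_cat adj_graft => Hv; case/or4P.
- move=> a; have /andP[yl zl] := adj_labels a; rewrite yl zl.
  by case: ifP Hv => [vl _|vl /= vr]; [exact: IHl|have := dl _ _ a; lia].
- move=> a; have /andP[/D-> /D->] := adj_labels a.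
  by case: ifP Hv => [vl _|vl /= vr]; [have := dr _ _ a; lia|exact: IHr].
- case/andP=> /eqP-> /eqP->; rewrite root_labels (D _ (root_labels r)).
  case: ifP Hv => [vl _|vl /= vr].
    by rewrite dist_rootr // depth_root // addn0.
  by rewrite dist_rootr // depth_root //; lia.
- case/andP=> /eqP-> /eqP->; rewrite root_labels (D _ (root_labels r)).
  case: ifP Hv => [vl _|vl /= vr].
    by rewrite dist_rootr // depth_root // addn0; lia.
  by rewrite dist_rootr // depth_root //; lia.
Qed.

Lemma dist_walk T x y : uniq (labels T) -> x \in labels T -> y \in labels T ->
  exists2 s, path (tree_adj T) x s && (last x s == y) & size s = tree_dist T x y.
Proof.
elim: T x y => /= [a x y _|l IHl r IHr x y /(@uniq_graft l r)[Ul Ur D]].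
  by rewrite !inE => /eqP-> /eqP->; exists [::] => //=.
have subl : subrel (tree_adj l) (tree_adj (Graft l r)) by move=> u v; rewrite adj_graft => ->.
have subr : subrel (tree_adj r) (tree_adj (Graft l r)).
  by move=> u v; rewrite adj_graft => ->; rewrite orbT.
have cross x' y' : x' \in labels l -> y' \in labels r ->
    exists2 s, path (tree_adj (Graft l r)) x' s && (last x' s == y')
             & size s = (depth l x').+1 + depth r y'.
  move=> xl yr; have [s1 /andP[p1 /eqP e1] z1] := IHl _ _ Ul xl (root_labels l).
  have [s2 /andP[p2 e2] z2] := IHr _ _ Ur (root_labels r) yr.
  exists (s1 ++ root_label r :: s2).
    rewrite cat_path last_cat /= (sub_path subl) // e1 e2 (sub_path subr) //.
    by rewrite adj_graft !eqxx !orbT.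
  by rewrite size_cat /= z1 z2 dist_rootr // dist_rootl //; lia.
have cross' x' y' : x' \in labels r -> y' \in labels l ->
    exists2 s, path (tree_adj (Graft l r)) x' s && (last x' s == y')
             & size s = (depth l y').+1 + depth r x'.
  move=> xr yl; have [s1 /andP[p1 /eqP e1] z1] := IHr _ _ Ur xr (root_labels r).
  have [s2 /andP[p2 e2] z2] := IHl _ _ Ul (root_labels l) yl.
  exists (s1 ++ root_label l :: s2).
    rewrite cat_path last_cat /= (sub_path subr) // e1 e2 (sub_path subl) //.
    by rewrite adj_graft !eqxx !orbT.
  by rewrite size_cat /= z1 z2 dist_rootr // dist_rootl //; lia.
rewrite !mem_cat; case: ifP => xl /= xr; case: ifP => yl /= yr.
- have [s /andP[p e] z] := IHl _ _ Ul xl yl; exists s => //.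
  by rewrite (sub_path subl).
- exact: cross.
- exact: cross'.
- have [s /andP[p e] z] := IHr _ _ Ur xr yr; exists s => //.
  by rewrite (sub_path subr).
Qed.

(** * Nodes far from the childless nodes of a fringe subtree *)

(** In a fringe subtree the root has a parent outside, so the nodes of degree 1
    are the childless ones; this is why the root is treated like the others. *)
Definition far k T v := all (fun x => childless T x ==> (k <= tree_dist T v x)) (labels T).

Lemma leaf_depthE k T : uniq (labels T) ->
  (k <= leaf_depth T) = all (fun x => childless T x ==> (k <= depth T x)) (labels T).
Proof.
elim: T k => [a|l IHl r IHr] k; first by rewrite /= eqxx andbT.
move=> U; have [Ul Ur D] := uniq_graft U; rewrite /= all_cat.
have -> : all (fun x => childless (Graft l r) x ==> (k <= depth (Graft l r) x)) (labels l)
    = (k.-1 <= leaf_depth l).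
  rewrite IHl //; apply: eq_in_all => x xl /=; rewrite xl; lia.
have -> : all (fun x => childless (Graft l r) x ==> (k <= depth (Graft l r) x)) (labels r)
    = is_node r || (k <= leaf_depth r).
  have [nr|nr] /= := boolP (is_node r).
    by case: r nr {IHr U Ur} D => // a _ D /=; rewrite (D a) ?eqxx ?andbF // inE.
  rewrite IHr //; apply: eq_in_all => x xr; rewrite (D x xr).
  case: (x =P root_label r) => [->|]; last by rewrite andbT.
  by rewrite childless_root // (negbTE nr).
by case: (is_node r) => /=; lia.
Qed.

Lemma branches_deepE j T : uniq (labels T) ->
  branches_deep j T =
  all (fun x => childless T x && (x != root_label T) ==> (j < depth T x)) (labels T).
Proof.
move=> U; rewrite /branches_deep; case: T U => [a|l r] U; first by rewrite /= eqxx.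
rewrite [is_node _]/= orFb leaf_depthE //; apply: eq_in_all => x _.
case: (x =P root_label (Graft l r)) => [->|]; last by rewrite andbT.
by rewrite childless_root.
Qed.

Lemma far_graftl k l r v : uniq (labels (Graft l r)) -> v \in labels l ->
  far k (Graft l r) v = far k l v && branches_deep (k - (depth l v).+2) r.
Proof.
move=> U vl; have [Ul Ur D] := uniq_graft U.
rewrite /far /= all_cat vl; congr (_ && _).
  by apply: eq_in_all => x xl; rewrite xl.
rewrite branches_deepE //; apply: eq_in_all => x xr; rewrite D //.
have := depth_gt0 Ur xr; case: (x != root_label r); rewrite ?andbF //.
case: (childless r x) => //=; lia.
Qed.

Lemma far_graftr k l r v : uniq (labels (Graft l r)) -> v \in labels r -> 0 < depth r v ->
  far k (Graft l r) v = (k - (depth r v).+1 <= leaf_depth l) && far k r v.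
Proof.
move=> U vr dv; have [Ul Ur D] := uniq_graft U.
rewrite /far /= all_cat D //; congr (_ && _).
  rewrite leaf_depthE //; apply: eq_in_all => x xl; rewrite xl.
  case: (childless l x) => //=; lia.
apply: eq_in_all => x xr; rewrite D //.
case: (x =P root_label r) => [->|]; last by rewrite andbT.
rewrite childless_root // andbF; case: r dv {U vr Ur D xr} => //.
Qed.

Definition far_nodes k d T := [seq v <- labels T | (depth T v == d) && far k T v].

Lemma size_far_nodes k d T : uniq (labels T) -> size (far_nodes k d T) = far_count k T d.
Proof.
rewrite size_filter.
have base T' : uniq (labels T') ->
    count (fun v => (depth T' v == 0) && far k T' v) (labels T') = (k <= leaf_depth T').
  move=> U; rewrite (@eq_in_count _ _ (fun v => far k T' (root_label T') && (v == root_label T'))).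
    have -> : (k <= leaf_depth T') = far k T' (root_label T').
      by rewrite leaf_depthE //; apply: eq_all => x; rewrite dist_rootl.
    by case: far; rewrite /= ?count_pred0 // count_uniq_mem // root_labels.
  move=> v vT; rewrite andbC; have := depth_gt0 U vT.
  case: (v =P root_label T') => [->|_] /=; first by rewrite depth_root.
  by case: depth => //= n _; rewrite !andbF.
elim: T d => [a|l IHl r IHr] [|d] U.
- by rewrite base.
- by rewrite /= addn0.
- by rewrite base.
have [Ul Ur D] := uniq_graft U.
rewrite [labels _]/= count_cat [far_count _ _ _]/= -IHl // -IHr //; congr (_ + _).
  rewrite (@eq_in_count _ _ (fun v => ((depth l v == d) && far k l v) && branches_deep (k - d.+2) r)).
    case: branches_deep; first by rewrite muln1; apply: eq_count => x; rewrite andbT.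
    by rewrite muln0 -(count_pred0 (labels l)); apply: eq_count => x; rewrite andbF.
  move=> v vl; rewrite far_graftl //= vl eqSS -andbA.
  by case: eqP => // ->.
rewrite (@eq_in_count _ _ (fun v => (k - d.+2 <= leaf_depth l) && ((depth r v == d.+1) && far k r v))).
  case: (_ <= leaf_depth l); first by rewrite mul1n.
  by rewrite mul0n count_pred0.
move=> v vr; rewrite [depth _ _]/= D //.
case: eqP => E; last by rewrite andbF.
by rewrite far_graftr ?E.
Qed.

Fixpoint fringe_nodes (s : ltree -> seq nat) T : seq nat :=
  if T is Graft l r then s l ++ fringe_nodes s l ++ fringe_nodes s r else [::].

Lemma size_fringe_nodes s T :
  size (fringe_nodes s T) = fringe_sum (fun t => size (s t)) T.
Proof. by elim: T => //= l Hl r Hr; rewrite !size_cat Hl Hr addnA. Qed.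

Lemma eq_uniq_fringe_sum f g T : (forall t, uniq (labels t) -> f t = g t) ->
  uniq (labels T) -> fringe_sum f T = fringe_sum g T.
Proof.
move=> E; elim: T => //= l IHl r IHr /(@uniq_graft l r)[Ul Ur _].
by rewrite E // IHl // IHr.
Qed.

(** A node has only one d-th ancestor: if s selects only nodes at depth d, then
    no node is selected in two different fringe subtrees. *)
Definition selects d (s : ltree -> seq nat) := forall T, uniq (labels T) ->
  uniq (s T) /\ {in s T, forall v, v \in labels T /\ depth T v = d}.

Lemma fringe_nodesP d s T : selects d s -> uniq (labels T) ->
  uniq (fringe_nodes s T) /\
  {in fringe_nodes s T, forall v, v \in labels T /\ d < depth T v}.
Proof.
move=> hs; elim: T => [//|l IHl r IHr] U; have [Ul Ur D] := uniq_graft U.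
have [Us Ps] := hs l Ul; have [Ufl Pl] := IHl Ul; have [Ufr Pr] := IHr Ur.
split.
  rewrite /= !cat_uniq Us Ufl Ufr /= andbT has_cat negb_or; apply/andP; split.
  - apply/andP; split; apply/hasPn => v.
      by move=> /Pl[_ dv]; apply/negP => /Ps[_ E]; rewrite E ltnn in dv.
    by move=> /Pr[/D vl _]; apply/negP => /Ps[]; rewrite vl.
  - by apply/hasPn => v /Pr[/D vl _]; apply/negP => /Pl[]; rewrite vl.
move=> v; rewrite /= !mem_cat => /or3P[/Ps[-> ->]|/Pl[-> h]|/Pr[h1 h2]] //.
  by split=> //; apply: ltnW.
by rewrite h1 orbT D.
Qed.

Lemma far_nodes_selects k d : selects d (far_nodes k d).
Proof.
move=> T U; split; first exact: filter_uniq.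
by move=> v; rewrite mem_filter => /andP[/andP[/eqP-> _] ->].
Qed.

(** A node childless in a fringe subtree is childless in the whole tree. *)
Lemma far_fringe k d T v : uniq (labels T) -> v \in labels T -> d < depth T v ->
  far k T v -> v \in fringe_nodes (far_nodes k d) T.
Proof.
elim: T => [//|l IHl r IHr] U; have [Ul Ur D] := uniq_graft U.
rewrite [v \in labels _]mem_cat [depth _ _]/= => Hv dv F; rewrite /= !mem_cat.
case: ifP dv Hv => vl dv Hv.
  move: F; rewrite far_graftl // => /andP[F _].
  move: dv; rewrite ltnS leq_eqVlt => /orP[/eqP E|dv].
    by rewrite mem_filter -E eqxx F vl.
  by rewrite IHl ?orbT.
have dv0 : 0 < depth r v by exact: leq_ltn_trans dv.
by move: F; rewrite far_graftr // => /andP[_ F]; rewrite IHr ?orbT.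
Qed.

(** A walk from v to the outside of the fringe subtree of its d-th ancestor
    takes at least d + 1 steps. *)
Lemma fringe_far k d T v : uniq (labels T) -> k <= d.+1 ->
  v \in fringe_nodes (far_nodes k d) T -> far k T v.
Proof.
move=> U kd; elim: T U => [//|l IHl r IHr] U; have [Ul Ur D] := uniq_graft U.
rewrite /= !mem_cat => /or3P[|vl|vr].
- rewrite mem_filter => /andP[/andP[/eqP dv F] vl]; rewrite far_graftl // F dv.
  rewrite branches_deepE //; apply/allP => x xr; apply/implyP => /andP[_ xr0].
  by rewrite (eqP (_ : k - d.+2 == 0)) ?depth_gt0 // subn_eq0 ltnW.
- have [_ /(_ _ vl)[vll dv]] := fringe_nodesP (@far_nodes_selects k d) Ul.
  rewrite far_graftl // IHl //= branches_deepE //.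
  apply/allP => x xr; apply/implyP => /andP[_ xr0].
  by rewrite (eqP (_ : k - _ == 0)) ?depth_gt0 //; lia.
- have [_ /(_ _ vr)[vrr dv]] := fringe_nodesP (@far_nodes_selects k d) Ur.
  rewrite far_graftr // ?IHr // ?andbT; last exact: leq_ltn_trans dv.
  by rewrite (eqP (_ : k - _ == 0)) //; lia.
Qed.

(** In a path rooted at one end, always entering the grafted part goes down the
    path, so that d is the depth of the node reached. *)
Fixpoint path_node d T :=
  match d, T with d'.+1, Graft l _ => path_node d' l | _, _ => root_label T end.

(** In a fringe path with 2k nodes, the node at depth k - 1 is k steps above the
    bottom of the path and k steps below the parent of the top: its rank in the
    whole tree is k. *)
Definition path_middle k T := if is_path k.*2.-1 T then [:: path_node k.-1 T] else [::].

Lemma path_nodeP n d T : uniq (labels T) -> is_path n T -> d <= n ->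
  [/\ path_node d T \in labels T, depth T (path_node d T) = d,
      (forall x, childless T x = (x == path_node n T)) &
      tree_dist T (path_node d T) (path_node n T) = n - d].
Proof.
elim: T n d => [a|l IHl r _] [|n] d U //=.
  by case: d => // _ _; rewrite inE eqxx.
have [Ul Ur D] := uniq_graft U; case: r U Ur D => [b|? ?] U Ur D /=; last by rewrite andbF.
rewrite andbT => Pl dn.
have bl : (b \in labels l) = false by apply: D; rewrite inE.
have ch x : (if x \in labels l then childless l x else (x == b) && (x != b)) = (x == path_node n l).
  have [h1 h2 h3 _] := IHl n n Ul Pl (leqnn n).
  case: ifP => xl; first by rewrite h3.
  by rewrite andbN; apply/esym/eqP => E; rewrite E h1 in xl.
have [h1 h2 h3 h4] := IHl n n Ul Pl (leqnn n).
case: d dn => [|d] dn /=.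
  split=> //; rewrite ?mem_cat ?inE ?eqxx ?orbT ?bl //.
  by rewrite h1 h2 addn0 subn0.
have [g1 g2 g3 g4] := IHl n d Ul Pl dn.
by rewrite mem_cat g1 h1 g2 g4.
Qed.

Lemma middle_selects k : selects k.-1 (path_middle k).
Proof.
move=> T U; rewrite /path_middle; case: ifP => // P; split=> // v; rewrite inE => /eqP->.
by have [] := @path_nodeP k.*2.-1 k.-1 T U P _; first by lia.
Qed.

Lemma middle_far k T v : 0 < k -> uniq (labels T) -> v \in fringe_nodes (path_middle k) T ->
  v \in fringe_nodes (far_nodes k k.-1) T /\ exists2 x, childless T x & tree_dist T v x = k.
Proof.
move=> k0; elim: T => [//|l IHl r IHr] U; have [Ul Ur D] := uniq_graft U.
rewrite /= !mem_cat => /or3P[|vl|vr].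
- rewrite /path_middle; case: ifP => // P; rewrite inE => /eqP->.
  have [g1 g2 g3 g4] := @path_nodeP k.*2.-1 k.-1 l Ul P ltac:(lia).
  have [h1 h2 h3 h4] := @path_nodeP k.*2.-1 k.*2.-1 l Ul P ltac:(lia).
  split.
    rewrite mem_filter g1 g2 eqxx /= /far; apply/orP; left; rewrite andbT.
    apply/allP => x xl; apply/implyP; rewrite g3 => /eqP->; rewrite g4; lia.
  by exists (path_node k.*2.-1 l); rewrite /= h1 ?h3 ?g1 ?g4 //; lia.
- have [g [x xl E]] := IHl Ul vl; rewrite g orbT; split=> //.
  have [_ /(_ _ g)[vll _]] := fringe_nodesP (@far_nodes_selects k k.-1) Ul.
  by have h := childless_labels xl; exists x; rewrite /= h // vll.
- have [g [x xr E]] := IHr Ur vr; rewrite g !orbT; split=> //.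
  have [_ /(_ _ g)[vrr dv]] := fringe_nodesP (@far_nodes_selects k k.-1) Ur.
  have h := childless_labels xr; exists x; rewrite /= !D //.
  rewrite xr; apply/eqP => Ex; move: xr; rewrite Ex childless_root //.
  by case: r dv {IHr U Ur D vr g E vrr h Ex}.
Qed.

(** * Building a labelled tree from its parent function *)

Fixpoint attach T j b : ltree :=
  match T with
  | Node a => if a == j then Graft (Node b) (Node a) else Node a
  | Graft l r => Graft (attach l j b) (attach r j b)
  end.

Lemma attach_notin T j b : j \notin labels T -> attach T j b = T.
Proof.
elim: T => /= [a|l IHl r IHr]; first by rewrite inE eq_sym => /negbTE->.
by rewrite mem_cat negb_or => /andP[/IHl-> /IHr->].
Qed.

Lemma root_attach T j b : root_label (attach T j b) = root_label T.
Proof. by elim: T => //= a; case: ifP. Qed.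

Lemma labels_attach T j b : uniq (labels T) -> j \in labels T ->
  perm_eq (labels (attach T j b)) (b :: labels T).
Proof.
elim: T => [a _|l IHl r IHr U]; first by rewrite /= inE eq_sym => ->.
have [Ul Ur D] := uniq_graft U; rewrite mem_cat => /orP[jl|jr] /=.
  have jr : j \notin labels r by apply/negP => /D; rewrite jl.
  by rewrite (attach_notin b jr) -cat_cons perm_cat2r IHl.
by rewrite attach_notin ?D // -cat_cons -cat1s -catA perm_sym perm_catCA perm_cat2l perm_sym IHr.
Qed.

Lemma parent_attach T j b x y : uniq (labels T) -> j \in labels T ->
  parent_of (attach T j b) x y = parent_of T x y || (x == b) && (y == j).
Proof.
elim: T => [a _|l IHl r IHr U]; first by rewrite /= inE => /eqP->; rewrite eqxx.
have [Ul Ur D] := uniq_graft U; rewrite mem_cat => /orP[jl|jr] /=.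
  have jr : j \notin labels r by apply/negP => /D; rewrite jl.
  rewrite (attach_notin b jr) root_attach IHl // -!orbA; congr (_ || _).
  by rewrite orbCA; congr (_ || _); rewrite orbC.
rewrite [attach l j b]attach_notin ?D // root_attach IHr // -!orbA; do 2 congr (_ || _).
by rewrite orbC.
Qed.

(** A uniform choice of the label to attach to is, once labels are forgotten, a
    uniform choice in [grow]. *)
Lemma unlabel_attach T b : uniq (labels T) ->
  [seq unlabel (attach T j b) | j <- labels T] = grow (unlabel T).
Proof.
elim: T => [a _|l IHl r IHr U]; first by rewrite /= eqxx.
have [Ul Ur D] := uniq_graft U.
rewrite [labels _]/= map_cat [unlabel _]/= [grow _]/= -IHl // -IHr // -!map_comp.
congr (_ ++ _); apply/eq_in_map => j Hj /=; congr Graft.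
  by rewrite attach_notin //; apply/negP => /D; rewrite Hj.
by rewrite attach_notin ?D.
Qed.

Section Build.
Variable q : nat -> nat.

Fixpoint build n : ltree := if n is m.+1 then attach (build m) (q n) n else Node 0.

Definition valid_parents n := forall i, 0 < i <= n -> q i < i.

Lemma validS n : valid_parents n.+1 -> valid_parents n.
Proof. by move=> V i /andP[i0 le]; apply: V; rewrite i0 leqW. Qed.

Lemma labels_build n : valid_parents n -> perm_eq (labels (build n)) (iota 0 n.+1).
Proof.
elim: n => // n IH V; have P := IH (validS V).
have U : uniq (labels (build n)) by rewrite (perm_uniq P) iota_uniq.
have qn : q n.+1 \in labels (build n).
  by rewrite (perm_mem P) mem_iota add0n; apply: V; rewrite leqnn.
rewrite (perm_trans (labels_attach _ U qn)) //.
rewrite -[n.+2]addn1 iotaD add0n /= perm_sym.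
by rewrite -cat_cons perm_catC /= perm_cons perm_sym.
Qed.

Lemma uniq_build n : valid_parents n -> uniq (labels (build n)).
Proof. by move=> /labels_build/perm_uniq->; rewrite iota_uniq. Qed.

Lemma mem_build n x : valid_parents n -> (x \in labels (build n)) = (x <= n).
Proof. by move=> /labels_build/perm_mem->; rewrite mem_iota. Qed.

Lemma root_build n : root_label (build n) = 0.
Proof. by elim: n => //= n; rewrite root_attach. Qed.

Lemma parent_build n x y : valid_parents n -> parent_of (build n) x y = (0 < x <= n) && (q x == y).
Proof.
elim: n => [|n IH] V; first by rewrite /=; case: x.
have V' := validS V; rewrite /= parent_attach ?uniq_build //; last first.
  by rewrite mem_build // -ltnS V // leqnn.
rewrite IH // (eq_sym y); case: (x =P n.+1) => [->|ne] /=; first by rewrite ltnn leqnn.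
by rewrite orbF; congr (_ && _); lia.
Qed.

End Build.

Lemma eq_build q1 q2 n : (forall i, i <= n -> q1 i = q2 i) -> build q1 n = build q2 n.
Proof.
elim: n => //= n IH H; rewrite IH ?H // => i le; apply: H; exact: leqW.
Qed.

Lemma depth_countE (T : ltree) d : uniq (labels T) ->
  depth_count T d = count (fun v => depth T v <= d) (labels T).
Proof.
elim: T d => [a|l IHl r IHr] d U //=; have [Ul Ur D] := uniq_graft U.
rewrite count_cat IHr //; congr (_ + _); last by apply: eq_in_count => v /D->.
case: d => [|d].
  by rewrite -[LHS](count_pred0 (labels l)); apply: eq_in_count => v ->.
by rewrite IHl //; apply: eq_in_count => v ->.
Qed.

End Labelled.

(** * Rank in the graph of a recursive tree *)

Section Graph.
Variables (n : nat) (p : {ffun 'I_n.+1 -> 'I_n.+1}).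
Local Notation q := (fun i => p (inord i) : nat).
Local Notation T := (build q n).
Local Notation e := (tree_edge p).
Hypothesis n_gt0 : 0 < n.
Hypothesis p_lt : forall i : 'I_n.+1, 0 < i -> p i < i.

Let V : valid_parents q n.
Proof.
move=> i /andP[i0 le] /=; have E : (@inord n i : nat) = i by rewrite inordK // ltnS.
by rewrite -[X in _ < X]E p_lt // E.
Qed.

Let U : uniq (labels T). Proof. exact: uniq_build. Qed.

Let mem_lab (v : 'I_n.+1) : (v : nat) \in labels T.
Proof. by rewrite mem_build // -ltnS. Qed.

Lemma tree_edgeE (i j : 'I_n.+1) : e i j = tree_adj T i j.
Proof.
rewrite /tree_edge /tree_adj /= !parent_build //= !inord_val.
have h (x : 'I_n.+1) : x <= n by rewrite -ltnS.
by rewrite !h !andbT.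
Qed.

Lemma childless_ord (x : 'I_n.+1) : childless T x = [forall y : 'I_n.+1, (0 < y) ==> (p y != x)].
Proof.
apply/(childlessE _ U)/forallP => [[_ H] y|H].
  apply/implyP => y0; apply: contra (H y) => /eqP E.
  by rewrite parent_build // y0 /= -ltnS ltn_ord inord_val E eqxx.
split=> // y; rewrite parent_build //; apply/negP => /andP[/andP[y0 yn]] /eqP E.
have Ey : (@inord n y : nat) = y by rewrite inordK // ltnS.
by have /implyP := H (inord y); rewrite Ey => /(_ y0) /eqP; apply; apply: val_inj.
Qed.

Lemma childless_neq0 (x : 'I_n.+1) : childless T x -> 0 < x.
Proof.
rewrite childless_ord => /forallP H; rewrite lt0n; apply/eqP => x0.
have E : (@inord n 1 : nat) = 1 by rewrite inordK // ltnS.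
have := H (inord 1); rewrite E /= => /eqP; apply; apply: val_inj.
have := @p_lt (inord 1); rewrite E => /(_ isT); rewrite ltnS leqn0 => /eqP h.
by rewrite /= h x0.
Qed.

(** The parent of x is a neighbour of x, so x has degree 1 when it has no child.
    The root is different: it is a leaf when it has a single child. *)
Lemma leaf_childless (x : 'I_n.+1) : 0 < x -> leaf e x = childless T x.
Proof.
move=> x0; rewrite childless_ord /leaf /degree.
have px : p x \in [set y | e x y] by rewrite inE /tree_edge /= x0 eqxx.
apply/eqP/forallP => [/eqP/cards1P[z Ez] y|H].
  apply/implyP => y0; apply/negP => /eqP E.
  have : y \in [set y | e x y] by rewrite inE /tree_edge /= y0 E eqxx orbT.
  move: px; rewrite Ez !inE => /eqP Epx /eqP Ey.
  by have := p_lt x0; have := p_lt y0; rewrite E Ey -Epx; lia.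
rewrite -(cards1 (p x)); congr #|pred_of_set _|; apply/setP => y; rewrite !inE /tree_edge /= x0 /=.
rewrite [RHS]eq_sym; case: eqP => //= _; apply/negP => /andP[y0 E].
by have := H y; rewrite y0 E.
Qed.

Lemma walk_dist (x y : 'I_n.+1) d : has_walk e x y d -> tree_dist T x y <= d.
Proof.
case/existsP => s /andP[]; rewrite -[X in _ <= X](size_tuple s).
(* Along a walk, the distance to x grows by at most 1 per step. *)
have gen (z : 'I_n.+1) (s' : seq 'I_n.+1) : path e z s' -> tree_dist T x (last z s') <= tree_dist T x z + size s'.
  elim: s' z => [|w s' IH] z /=; first by rewrite addn0.
  case/andP; rewrite tree_edgeE => a /IH.
  by have := dist_adj U (mem_lab x) a; lia.
move/gen => + /eqP E; rewrite E.
by rewrite tree_distxx.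
Qed.

Lemma dist_has_walk (x y : 'I_n.+1) : has_walk e x y (tree_dist T x y).
Proof.
have [s /andP[P L] <-] := dist_walk U (mem_lab x) (mem_lab y).
have : all (fun z => z < n.+1) s.
  elim: s (x : nat) P {L} => //= z s IH x' /andP[/adj_labels/andP[_]].
  by rewrite mem_build // ltnS => -> /IH.
move=> B; have E : s = map val (map (@inord n) s).
  rewrite -map_comp -[LHS]map_id; apply/eq_in_map => z /(allP B) zn /=.
  by rewrite inordK.
move: P L; rewrite E size_map => P /eqP L.
apply/existsP; exists (in_tuple (map (@inord n) s)) => /=.
move: L; rewrite last_map => /val_inj->; rewrite eqxx andbT.
move: P; rewrite (@path_map _ _ val (tree_adj T)).
by rewrite (@eq_path _ _ e) // => u v; rewrite tree_edgeE.
Qed.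

Lemma gdist_le (x y : 'I_n.+1) : gdist e x y <= tree_dist T x y.
Proof.
rewrite leqNgt /gdist; apply/negP => H.
have := before_find 0 H; rewrite nth_iota ?dist_has_walk //.
by apply: leq_trans H _; rewrite -[X in _ <= X](size_iota 0); apply: find_size.
Qed.

Lemma gdist_ge (x y : 'I_n.+1) k : k <= n.+1 -> k <= tree_dist T x y -> k <= gdist e x y.
Proof.
move=> kn H; rewrite leqNgt; apply/negP => g.
have gn : gdist e x y < #|'I_n.+1| by rewrite card_ord (leq_trans g).
have : has (has_walk e x y) (iota 0 #|'I_n.+1|) by rewrite has_find size_iota.
move/(nth_find 0); rewrite nth_iota //= add0n => /walk_dist.
by rewrite -/(gdist e x y); lia.
Qed.

Let has_leaf : [exists l, leaf e l].
Proof.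
(* The last node has no child. *)
apply/existsP; exists ord_max; rewrite leaf_childless // childless_ord.
apply/forallP => y; apply/implyP => /p_lt py.
by apply/eqP => E; move: py; rewrite E ltnNge -ltnS ltn_ord.
Qed.

(** The minimum defining the rank starts from the number n.+1 of nodes, which
    does not interfere with thresholds up to n.+1. *)
Lemma rank_geP k (v : 'I_n.+1) : k <= n.+1 ->
  (k <= rank e v) = [forall l, leaf e l ==> (k <= gdist e v l)].
Proof.
move=> kn; rewrite /rank has_leaf.
rewrite (@big_morph _ _ (fun m => k <= m) true andb); last by rewrite card_ord.
  by rewrite big_andE.
exact: leq_min.
Qed.

Lemma rank_far k (v : 'I_n.+1) : k <= n.+1 -> k <= rank e v -> far k T v.
Proof.
move=> kn; rewrite rank_geP // => /forallP H; apply/allP => x.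
rewrite mem_build // -ltnS => xn; apply/implyP => c.
have := H (Ordinal xn); rewrite leaf_childless ?c /=; last exact: (@childless_neq0 (Ordinal xn)).
by move=> h; apply: leq_trans h _; apply: gdist_le.
Qed.

(** The depth condition takes care of the root, which may be a leaf although it
    has a child. *)
Lemma far_rank k (v : 'I_n.+1) : k <= n.+1 -> k <= depth T v -> far k T v -> k <= rank e v.
Proof.
move=> kn kd /allP F; rewrite rank_geP //; apply/forallP => l; apply/implyP => L.
apply: gdist_ge => //; case: (posnP l) => [l0|l0].
  by rewrite l0 -[0](root_build q n) dist_rootr.
by have /implyP := F _ (mem_lab l); apply; rewrite -leaf_childless.
Qed.

Lemma rank_le_dist (v : 'I_n.+1) x :
  tree_dist T v x <= n -> childless T x -> rank e v <= tree_dist T v x.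
Proof.
move=> dn c; have xn : x < n.+1 by rewrite ltnS -(@mem_build q) // childless_labels.
rewrite leqNgt rank_geP //; apply/negP => /forallP/(_ (Ordinal xn)).
rewrite leaf_childless ?c /=; last exact: (@childless_neq0 (Ordinal xn)).
by rewrite ltnNge (gdist_le v (Ordinal xn)).
Qed.

Lemma card_labels (P : pred 'I_n.+1) :
  #|[set v | P v]| = count (fun x => P (inord x)) (labels T).
Proof.
rewrite (permP (labels_build V)) -sum1_count big_mkcond.
rewrite -[iota _ _]/(index_iota 0 n.+1) big_mkord -big_mkcond sum1dep_card.
by apply: eq_card => v; rewrite !inE inord_val.
Qed.

(** The nodes counted on the left have depth at least k, so the root is not too
    close to them. *)
Lemma fringe_far_le_card k : 0 < k <= n.+1 ->
  fringe_sum (fun t => far_count k t k.-1) T <= #|[set v | k <= rank e v]|.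
Proof.
move=> /andP[k0 kn]; rewrite card_labels -size_filter.
have [Uf Pf] := fringe_nodesP (@far_nodes_selects k k.-1) U.
have -> : fringe_sum (fun t => far_count k t k.-1) T = size (fringe_nodes (far_nodes k k.-1) T).
  by rewrite size_fringe_nodes; apply: eq_uniq_fringe_sum => // t; move=> Ut; rewrite size_far_nodes.
apply: uniq_leq_size => // v Hv; have [vT dv] := Pf v Hv.
rewrite mem_filter vT andbT.
have E : (@inord n v : nat) = v by rewrite inordK // ltnS -(@mem_build q).
apply: far_rank => //; rewrite E; first by rewrite -(prednK k0).
by apply: fringe_far Hv; rewrite ?prednK.
Qed.

Lemma card_le_fringe_far k d : k <= n.+1 ->
  #|[set v | k <= rank e v]| <=
  fringe_sum (fun t => far_count k t d) T + depth_count T d.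
Proof.
move=> kn; rewrite card_labels -size_filter depth_countE // -size_filter.
have -> : fringe_sum (fun t => far_count k t d) T = size (fringe_nodes (far_nodes k d) T).
  by rewrite size_fringe_nodes; apply: eq_uniq_fringe_sum => // t; move=> Ut; rewrite size_far_nodes.
rewrite -size_cat; apply: uniq_leq_size; first exact: filter_uniq.
move=> v; rewrite mem_filter => /andP[R vT]; rewrite mem_cat mem_filter vT andbT.
have E : (@inord n v : nat) = v by rewrite inordK // ltnS -(@mem_build q).
case: leqP => [_|dv]; first by rewrite orbT.
by rewrite far_fringe //; have := rank_far kn R; rewrite E.
Qed.

Lemma fringe_path_le_card k : 0 < k <= n ->
  fringe_sum (fun t => is_path k.*2.-1 t : nat) T <= rank_count k p.
Proof.
move=> /andP[k0 kn]; rewrite /rank_count card_labels -size_filter.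
have [Uf Pf] := fringe_nodesP (@middle_selects k) U.
have -> : fringe_sum (fun t => is_path k.*2.-1 t : nat) T = size (fringe_nodes (path_middle k) T).
  by rewrite size_fringe_nodes; apply: eq_uniq_fringe_sum => // t _; rewrite /path_middle; case: is_path.
apply: uniq_leq_size => // v Hv; have [vT dv] := Pf v Hv.
rewrite mem_filter vT andbT.
have E : (@inord n v : nat) = v by rewrite inordK // ltnS -(@mem_build q).
have [Hf [x cx Ex]] := middle_far k0 U Hv.
rewrite eqn_leq; apply/andP; split.
  have := @rank_le_dist (inord v) x; rewrite E Ex; exact.
apply: far_rank; rewrite ?(leqW kn) // E; first by rewrite -(prednK k0).
by apply: fringe_far Hf; rewrite ?prednK.
Qed.

End Graph.

Local Open Scope ring_scope.

(** * The random recursive tree, without labels *)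

Section Mean.
Variable R : realFieldType.
Implicit Types (f g : tree unit -> R) (n : nat).

Lemma ler_sum_grow t f g : (forall t', tsize t' = (tsize t).+1 -> f t' <= g t') ->
  \sum_(t' <- grow t) f t' <= \sum_(t' <- grow t) g t'.
Proof.
elim: t f g => [a|l IHl r IHr] f g H; first by rewrite /= !big_seq1 H.
rewrite /= !big_cat !big_map lerD //.
  by apply: (IHl (fun l' => f (Graft l' r)) (fun l' => g (Graft l' r))) => t' E; apply: H; rewrite /= E.
by apply: (IHr (fun r' => f (Graft l r')) (fun r' => g (Graft l r'))) => t' E; apply: H; rewrite /= E addnS.
Qed.

(** Expectation of f for the random recursive tree with n + 1 nodes. *)
Fixpoint rrt_mean n f : R :=
  if n is m.+1 then m.+1%:R^-1 * rrt_mean m (fun t => \sum_(t' <- grow t) f t')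
  else f (Node tt).

Lemma ler_mean n f g : (forall t, tsize t = n.+1 -> f t <= g t) -> rrt_mean n f <= rrt_mean n g.
Proof.
elim: n f g => [|n IH] f g H /=; first exact: H.
apply: ler_wpM2l; first by rewrite invr_ge0.
by apply: IH => t tn; apply: ler_sum_grow => t' E; apply: H; rewrite E tn.
Qed.

Lemma eq_mean n f g : (forall t, tsize t = n.+1 -> f t = g t) -> rrt_mean n f = rrt_mean n g.
Proof. by move=> H; apply/le_anti/andP; split; apply: ler_mean => t /H ->. Qed.

Lemma meanD n f g : rrt_mean n (fun t => f t + g t) = rrt_mean n f + rrt_mean n g.
Proof.
elim: n f g => //= n IH f g; rewrite -mulrDr -IH; congr (_ * _).
by apply: eq_mean => t _; rewrite big_split.
Qed.

Lemma meanZ n c f : rrt_mean n (fun t => c * f t) = c * rrt_mean n f.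
Proof.
elim: n f => //= n IH f; rewrite mulrCA -IH; congr (_ * _).
by apply: eq_mean => t _; rewrite mulr_sumr.
Qed.

Lemma mean_cst n c : rrt_mean n (fun=> c) = c.
Proof.
elim: n => //= n IH; rewrite (@eq_mean _ _ (fun=> n.+1%:R * c)).
  by rewrite meanZ IH mulKf // pnatr_eq0.
by move=> t tn; rewrite big_const_seq count_predT size_grow tn iter_addr_0 mulr_natl.
Qed.

Lemma mean_ge0 n f : (forall t, 0 <= f t) -> 0 <= rrt_mean n f.
Proof. by move=> H; rewrite -(mean_cst n 0); apply: ler_mean => t _. Qed.

Lemma mean_sum n (I : Type) (s : seq I) (F : I -> tree unit -> R) :
  rrt_mean n (fun t => \sum_(i <- s) F i t) = \sum_(i <- s) rrt_mean n (F i).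
Proof.
elim: s => [|i s IH].
  by rewrite big_nil -[RHS](mean_cst n 0); apply: eq_mean => t _; rewrite big_nil.
by rewrite big_cons -IH -meanD; apply: eq_mean => t _; rewrite big_cons.
Qed.

Lemma meanS n f : n.+1%:R * rrt_mean n.+1 f = rrt_mean n (fun t => \sum_(t' <- grow t) f t').
Proof. by rewrite /= mulVKf // pnatr_eq0. Qed.

(** The tree with n + 2 nodes is cut into the branch l of the oldest child and
    the rest r, with i + 1 and n - i + 1 nodes. All sizes are equally likely:
    as in a Polya urn, the next node joins l with probability proportional to
    the size of l. *)
Lemma mean_split n f : n.+1%:R * rrt_mean n.+1 f =
  \sum_(i < n.+1) rrt_mean i (fun l => rrt_mean (n - i) (fun r => f (Graft l r))).
Proof.
elim: n f => [|n IH] f; first by rewrite big_ord1 /= big_seq1 invr1 !mul1r.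
apply: (@mulfI _ n.+1%:R); first by rewrite pnatr_eq0.
rewrite meanS IH.
pose M i j := rrt_mean i (fun l => rrt_mean j (fun r => f (Graft l r))).
have step (i : 'I_n.+1) :
    rrt_mean i (fun l => rrt_mean (n - i) (fun r => \sum_(t <- grow (Graft l r)) f t)) =
    i.+1%:R * M i.+1 (n.+1 - i.+1)%N + (n.+1 - i)%:R * M i (n.+1 - i)%N.
  rewrite /M subSS meanS subSn; last by rewrite -ltnS.
  rewrite -meanZ -meanD; apply: eq_mean => l _.
  rewrite meanS -mean_sum -meanD; apply: eq_mean => r _.
  by rewrite /= big_cat !big_map.
rewrite (eq_bigr _ (fun i _ => step i)) big_split /=.
have -> : \sum_(i < n.+1) i.+1%:R * M i.+1 (n.+1 - i.+1)%N =
          \sum_(i < n.+2) i%:R * M i (n.+1 - i)%N.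
  by rewrite [RHS]big_ord_recl mul0r add0r.
have -> : \sum_(i < n.+1) (n.+1 - i)%:R * M i (n.+1 - i)%N =
          \sum_(i < n.+2) (n.+1 - i)%:R * M i (n.+1 - i)%N.
  by rewrite [RHS]big_ord_recr /= subnn mul0r addr0.
rewrite -big_split mulr_sumr; apply: eq_bigr => i _ /=.
by rewrite -mulrDl -natrD subnKC // -ltnS.
Qed.

Lemma mean_split_prod n f g h : (forall l r, f (Graft l r) = g l * h r) ->
  n.+1%:R * rrt_mean n.+1 f = \sum_(i < n.+1) rrt_mean i g * rrt_mean (n - i) h.
Proof.
move=> H; rewrite mean_split; apply: eq_bigr => i _.
rewrite mulrC -meanZ; apply: eq_mean => l _.
by rewrite mulrC -meanZ; apply: eq_mean => r _.
Qed.

(** Let s_n be the left-hand side. Summing over the two parts of the cut gives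
    (n + 1) s_(n+1) = sum_(i <= n) (E_i[f] + 2 s_i); subtracting the same
    identity for n - 1 gives (n + 1) s_(n+1) = (n + 2) s_n + E_n[f], which
    telescopes after division by (n + 1)(n + 2). *)
Lemma mean_fringe_sum n (f : tree unit -> nat) :
  rrt_mean n (fun t => (fringe_sum f t)%:R) =
  n.+1%:R * \sum_(m < n) rrt_mean m (fun t => (f t)%:R) / (m.+1%:R * m.+2%:R).
Proof.
pose phi m := rrt_mean m (fun t => (f t)%:R).
pose s n := rrt_mean n (fun t => (fringe_sum f t)%:R).
have rec k : k.+1%:R * s k.+1 = \sum_(i < k.+1) (phi i + s i + s (k - i)%N).
  rewrite /s mean_split; apply: eq_bigr => i _.
  rewrite -meanD -[X in _ + X](mean_cst i) -meanD; apply: eq_mean => l _.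
  rewrite -[X in X + _](mean_cst (k - i)) -meanD; apply: eq_mean => r _.
  by rewrite /= !natrD.
have rec2 k : k.+1%:R * s k.+1 = \sum_(i < k.+1) (phi i + 2 * s i).
  rewrite rec big_split /= [X in _ + X](reindex_inj rev_ord_inj) /= -big_split.
  apply: eq_bigr => i _ /=; rewrite subSS subKn; last by rewrite -ltnS.
  by ring.
have diff k : k.+1%:R * s k.+1 = k.+2%:R * s k + phi k.
  case: k => [|k]; first by rewrite rec2 big_ord1 /s /=; ring.
  by rewrite rec2 big_ord_recr /= -rec2 -!natr1; ring.
rewrite -/(s n); elim: n => [|n IH]; first by rewrite /s /= big_ord0 mulr0.
apply: (@mulfI _ n.+1%:R); first by rewrite pnatr_eq0.
rewrite diff IH big_ord_recr /= -/(phi n).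
by field; rewrite !gt_eqF // ltr_wpDr.
Qed.

Lemma mean_depth_countS n d : rrt_mean n.+1 (fun t => (depth_count t d)%:R) =
  rrt_mean n (fun t => (depth_count t d)%:R) +
  (if d is d'.+1 then rrt_mean n (fun t => (depth_count t d')%:R) else 0) / n.+1%:R.
Proof.
apply: (@mulfI _ n.+1%:R); first by rewrite pnatr_eq0.
rewrite meanS.
rewrite (@eq_mean _ _ (fun t => n.+1%:R * (depth_count t d)%:R +
   (if d is d'.+1 then depth_count t d' else 0%N)%:R)).
  rewrite meanD meanZ mulrDr mulrCA divff ?pnatr_eq0 // mulr1; congr (_ + _).
  by case: d => //; rewrite mean_cst.
by move=> t tn; rewrite -natr_sum sum_depth_count tn natrD natrM.
Qed.

(** At each step there is exactly one good choice, the end of the path. *)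
Lemma mean_path n : rrt_mean n (fun t => (is_path n t)%:R) = (n`!)%:R^-1.
Proof.
have Enode m : rrt_mean m (fun t : tree unit => (is_node t)%:R) = (m == 0%N)%:R.
  case: m => //= m; rewrite (@eq_mean _ _ (fun=> 0)) ?mean_cst ?mulr0 //.
  move=> t _; rewrite -[RHS](@big1_eq R 0 +%R _ (grow t) predT).
  have H t' : tsize t' = (tsize t).+1 -> (is_node t')%:R = 0 :> R.
    by have := tsize_gt0 t; case: t' => //= _ t0 [E]; rewrite -E in t0.
  by apply/le_anti/andP; split; apply: ler_sum_grow => t' /H ->.
elim: n => [|n IH]; first by rewrite /= fact0 invr1.
apply: (@mulfI _ n.+1%:R); first by rewrite pnatr_eq0.
rewrite (@mean_split_prod _ _ (fun t => (is_path n t)%:R) (fun t => (is_node t)%:R)); last first.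
  by move=> l r /=; rewrite -natrM mulnb.
rewrite big_ord_recr /= subnn Enode IH eqxx mulr1 big1 ?add0r; last first.
  by move=> i _; rewrite Enode subn_eq0 leqNgt ltn_ord mulr0.
by rewrite factS natrM invfM mulVKf // pnatr_eq0.
Qed.

End Mean.

Section Attachment.
Variable R : realFieldType.

Lemma sum_ffun_recr (T : finType) m (F : {ffun 'I_m.+1 -> T} -> R) :
  \sum_p F p = \sum_(p : {ffun 'I_m -> T}) \sum_x
    F [ffun i => if unlift ord_max i is Some j then p j else x].
Proof.
rewrite pair_big /=.
rewrite (reindex (fun px : {ffun 'I_m -> T} * T =>
   [ffun i => if unlift ord_max i is Some j then px.1 j else px.2])) //.
exists (fun p : {ffun 'I_m.+1 -> T} => ([ffun j : 'I_m => p (lift ord_max j)], p ord_max)) => [[p x] _|p _] /=.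
  congr (_, _); last by rewrite ffunE unlift_none.
  by apply/ffunP => j; rewrite !ffunE liftK.
by apply/ffunP => i; rewrite ffunE; case: unliftP => [j|] ->; rewrite ?ffunE.
Qed.

Definition choice_prob N (i : nat) (x : 'I_N) : R :=
  if (0 < i)%N then (if (x < i)%N then i%:R^-1 else 0) else ((x : nat) == i)%:R.

(** Bridge to the model with parent functions, by induction on the number m of
    parents drawn. Values in 'I_N with a fixed N allow m to vary. *)
Lemma mean_attachment N m (F : tree unit -> R) : (m < N)%N ->
  \sum_(p : {ffun 'I_m.+1 -> 'I_N}) (\prod_(i < m.+1) choice_prob i (p i)) *
     F (unlabel (build (fun i => p (inord i)) m)) = rrt_mean m F.
Proof.
elim: m F => [|m IH] F mN /=.
  rewrite -mulr_suml; set s := BIG_F.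
  rewrite -[RHS]mul1r; congr (_ * _).
  pose w (i : 'I_1) (x : 'I_N) : R := choice_prob i x.
  rewrite -(bigA_distr_bigA w) big_ord1 (bigD1 (Ordinal mN)) //= /w /choice_prob /=.
  rewrite big1 ?addr0 // => x; rewrite -val_eqE /= => /negbTE->; by [].
rewrite sum_ffun_recr -IH; last exact: ltnW.
rewrite mulr_sumr; apply: eq_bigr => p _.
(* g x extends the parent function p by the parent x of the last node. *)
pose g x : {ffun 'I_m.+2 -> 'I_N} := [ffun i => if unlift ord_max i is Some j then p j else x].
have gS x (i : 'I_m.+1) : g x (widen_ord (leqnSn m.+1) i) = p i.
  rewrite ffunE; have -> : widen_ord (leqnSn m.+1) i = lift ord_max i.
    by apply: val_inj; rewrite /= /bump leqNgt ltn_ord.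
  by rewrite liftK.
have gmax x : g x ord_max = x by rewrite ffunE unlift_none.
set q := fun i => p (inord i) : nat.
have step x : (\prod_(i < m.+2) choice_prob i (g x i)) *
      F (unlabel (attach (build (fun i => g x (inord i)) m) (g x (inord m.+1)) m.+1)) =
    (\prod_(i < m.+1) choice_prob i (p i)) *
      (choice_prob m.+1 x * F (unlabel (attach (build q m) x m.+1))).
  have -> : (@inord m.+1 m.+1) = ord_max by apply: val_inj; rewrite /= inordK.
  rewrite gmax mulrA big_ord_recr /= gmax; congr (_ * _ * F (unlabel (attach _ _ _))).
    by apply: eq_bigr => i _; rewrite gS.
  apply: eq_build => i im; rewrite /q -(gS x (inord i)).
  suff -> : @inord m.+1 i = widen_ord (leqnSn m.+1) (inord i) by [].
  by apply: val_inj; rewrite /= !inordK // ltnS // leqW.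
rewrite (eq_bigr _ (fun x _ => step x)) -mulr_sumr mulrCA.
have [->|W] := eqVneq (\prod_(i < m.+1) choice_prob i (p i)) 0; first by rewrite !mul0r.
congr (_ * _).
have V : valid_parents q m.
  move=> i /andP[i0 im]; rewrite ltnNge; apply/negP => le.
  case/negP: W; rewrite (bigD1 (inord i)) //= /choice_prob inordK ?ltnS // i0.
  by rewrite ltnNge le mul0r.
rewrite -(@unlabel_attach _ m.+1) ?uniq_build // big_map (perm_big _ (labels_build V)).
rewrite -[iota _ _]/(index_iota 0 m.+1) big_mkord.
rewrite (@big_ord_widen _ _ _ m.+1 N (fun x => F (unlabel (attach (build q m) x m.+1)))) 1?ltnW //.
rewrite mulr_sumr [RHS]big_mkcond; apply: eq_bigr => x _.
by rewrite /choice_prob /=; case: ifP => _; rewrite ?mul0r.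
Qed.

End Attachment.

(** * Decay of the probability that all leaves are deep *)

Section Sums.
Variable R : realFieldType.
Implicit Types a b : nat -> R.

Lemma sum_triangle_swap (G : nat -> nat -> R) N :
  \sum_(i < N) \sum_(l < N - i) G i l = \sum_(l < N) \sum_(i < N - l) G i l.
Proof.
have tri (F : nat -> nat -> R) :
    \sum_(i < N) \sum_(l < N - i) F i l = \sum_(i < N) \sum_(l < N | (i + l < N)%N) F i l.
  apply: eq_bigr => i _; rewrite (big_ord_widen N (F i)) ?leq_subr //.
  by apply: eq_bigl => l; rewrite ltn_subRL.
rewrite tri (tri (fun l i => G i l)) (exchange_big_dep predT) //=.
by apply: eq_bigr => l _; apply: eq_bigl => i; rewrite addnC.
Qed.

Lemma sum_convolution a b N :
  \sum_(n < N) \sum_(i < n.+1) a i * b (n - i)%N =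
  \sum_(i < N) a i * \sum_(m < N - i) b m.
Proof.
elim: N => [|N IH]; first by rewrite !big_ord0.
rewrite big_ord_recr /= IH [RHS]big_ord_recr /= subSnn big_ord1 [X in _ + X]big_ord_recr /= subnn addrA.
congr (_ + _); rewrite -big_split /=; apply: eq_bigr => i _.
by rewrite subSn ?(ltnW (ltn_ord i)) // big_ord_recr /= mulrDr.
Qed.

Lemma sum_le_widen b m n : (forall i, 0 <= b i) -> (m <= n)%N ->
  \sum_(i < m) b i <= \sum_(i < n) b i.
Proof.
move=> b0 mn; rewrite (big_ord_widen n b mn) big_mkcond; apply: ler_sum => i _.
by case: ifP.
Qed.

(** Truncated form of the evaluation of a product of power series at 1. *)
Lemma sum_convolution_le a b N : (forall i, 0 <= a i) -> (forall i, 0 <= b i) ->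
  \sum_(n < N) \sum_(i < n.+1) a i * b (n - i)%N <=
  (\sum_(i < N) a i) * \sum_(i < N) b i.
Proof.
move=> a0 b0; rewrite sum_convolution mulr_suml; apply: ler_sum => i _.
by rewrite ler_wpM2l // sum_le_widen // leq_subr.
Qed.
End Sums.

Section Decay.
Variable R : realFieldType.

(** The argument n refers to the tree with n + 1 nodes. *)
Definition deep_prob j n : R := rrt_mean n (fun t => (j <= leaf_depth t)%:R).
Definition branches_prob j n : R := rrt_mean n (fun t => (branches_deep j t)%:R).
Definition far_count_mean k d n : R := rrt_mean n (fun t => (far_count k t d)%:R).

Lemma deep_prob_ge0 j n : 0 <= deep_prob j n.
Proof. exact: mean_ge0. Qed.

Lemma branches_prob_ge0 j n : 0 <= branches_prob j n.
Proof. exact: mean_ge0. Qed.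

Lemma far_mean_ge0 k d n : 0 <= far_count_mean k d n.
Proof. exact: mean_ge0. Qed.

Lemma deep_prob_le1 j n : deep_prob j n <= 1.
Proof. by rewrite -(mean_cst n 1); apply: ler_mean => t _; case: leqP. Qed.

Lemma branches_prob0 j : branches_prob j 0 = 1.
Proof. by []. Qed.

Lemma branches_probS j n : n.+1%:R * branches_prob j n.+1 =
  \sum_(i < n.+1) deep_prob j i * branches_prob j (n - i).
Proof.
apply: mean_split_prod => l r.
by rewrite branches_deep_graft -mulnb natrM.
Qed.

Lemma deep_prob_small j n : (n < j)%N -> deep_prob j n = 0.
Proof.
move=> nj; rewrite -[RHS](mean_cst n 0); apply: eq_mean => t tn.
have := leaf_depth_ltsize t; rewrite tn => h; rewrite leqNgt.
by rewrite (leq_trans h nj).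
Qed.

Lemma deep_probS j n : deep_prob j.+1 n.+1 = branches_prob j n.+1.
Proof. by apply: eq_mean => -[a|l r] //=. Qed.

Lemma deep_prob_le_branches j n : deep_prob j.+1 n <= branches_prob j n.
Proof. by case: n => [|n]; [rewrite deep_prob_small // branches_prob_ge0|rewrite deep_probS]. Qed.

(** Partial sums at u = 1: [deep_sum] for P_j(u), the primitive of the series
    with coefficients [deep_prob j]; [branches_sum] for exp P_j; [far_sum] for
    the primitive of the series with coefficients [far_count_mean k d]. *)
Definition deep_sum N j : R := \sum_(i < N) deep_prob j i / i.+1%:R.
Definition branches_sum N j : R := \sum_(i < N) branches_prob j i.
Definition far_sum N k d : R := \sum_(i < N) far_count_mean k d i / i.+1%:R.

Lemma deep_sum_ge0 N j : 0 <= deep_sum N j.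
Proof. by apply: sumr_ge0 => i _; rewrite divr_ge0 ?deep_prob_ge0. Qed.

Lemma branches_sum_ge0 N j : 0 <= branches_sum N j.
Proof. by apply: sumr_ge0 => i _; exact: branches_prob_ge0. Qed.

Lemma far_sum_ge0 N k d : 0 <= far_sum N k d.
Proof. by apply: sumr_ge0 => i _; rewrite divr_ge0 ?far_mean_ge0. Qed.

(** For H = exp P with P(0) = 0 and nonnegative coefficients, H' = P' H is
    dominated coefficientwise by (P H)', so H - 1 is dominated by P H. *)
Lemma branches_prob_le_conv j n : branches_prob j n.+1 <=
  \sum_(i < n.+1) deep_prob j i / i.+1%:R * branches_prob j (n - i).
Proof.
rewrite -(ler_pM2l (ltr0Sn R n)) branches_probS mulr_sumr; apply: ler_sum => i _.
rewrite mulrA; apply: ler_wpM2r; first exact: branches_prob_ge0.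
rewrite mulrC -mulrA ler_peMr ?deep_prob_ge0 // mulrC ler_pdivlMr ?ltr0Sn //.
by rewrite mul1r ler_nat.
Qed.

Lemma branches_sum_le N j : branches_sum N j <= 1 + deep_sum N j * branches_sum N j.
Proof.
case: N => [|N]; first by rewrite /branches_sum big_ord0 mulr0 addr0.
rewrite {1}/branches_sum big_ord_recl branches_prob0 lerD2l.
pose a i : R := deep_prob j i / i.+1%:R.
have a0 i : 0 <= a i by rewrite divr_ge0 ?deep_prob_ge0.
apply: (@le_trans _ _ (\sum_(n < N) \sum_(i < n.+1) a i * branches_prob j (n - i))).
  by apply: ler_sum => i _; exact: branches_prob_le_conv.
apply: (le_trans (sum_convolution_le N a0 (branches_prob_ge0 j))).
apply: ler_pM; rewrite ?sumr_ge0 // ?sum_le_widen // => i *; exact: branches_prob_ge0.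
Qed.

(** Trees whose childless nodes have depth at least j + 1 have at least j + 2
    nodes, so the division by i + 1 gains a factor j + 2. *)
Lemma deep_sumS_le N j : j.+2%:R * deep_sum N.+1 j.+1 <= branches_sum N.+1 j - 1.
Proof.
rewrite /branches_sum big_ord_recl branches_prob0 addrC addrA addNr add0r.
rewrite /deep_sum big_ord_recl deep_prob_small // mul0r add0r mulr_sumr.
apply: ler_sum => i _ /=; rewrite /bump /= add1n deep_probS.
case: (ltnP i j) => ij.
  by rewrite -deep_probS deep_prob_small // mul0r mulr0.
rewrite mulrC -mulrA ler_piMr ?branches_prob_ge0 // mulrC ler_pdivrMr ?ltr0Sn //.
by rewrite mul1r ler_nat.
Qed.

Lemma deep_sumS_le_mul N j :
  j.+2%:R * deep_sum N.+1 j.+1 <= deep_sum N.+1 j * branches_sum N.+1 j.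
Proof. by have := deep_sumS_le N j; have := branches_sum_le N.+1 j; lra. Qed.

(** These numbers are the proportions of derangements of n + 1 objects. *)
Lemma branches_prob1_le n : branches_prob 1 n.+1 <= 2^-1.
Proof.
elim/ltn_ind: n => n IH.
rewrite -(ler_pM2l (ltr0Sn R n)) branches_probS big_ord_recl deep_prob_small // mul0r add0r.
case: n IH => [|n] IH; first by rewrite big_ord0; lra.
apply: (@le_trans _ _ (\sum_(i < n.+1) branches_prob 1 (n - i))).
  apply: ler_sum => i _ /=; rewrite /bump add1n subSS ler_piMl ?branches_prob_ge0 //.
  exact: deep_prob_le1.
rewrite (reindex_inj rev_ord_inj) /=.
rewrite (eq_bigr (fun i : 'I_n.+1 => branches_prob 1 i)); last first.
  by move=> i _; rewrite subSS subKn // -ltnS.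
rewrite big_ord_recl branches_prob0.
apply: (@le_trans _ _ (1 + \sum_(i < n) 2^-1)).
  by rewrite lerD2l; apply: ler_sum => i _; apply: IH; exact: ltnW (ltn_ord i).
rewrite sumr_const card_ord -mulr_natl (_ : n.+2%:R = n%:R + 2); last by rewrite -addn2 natrD.
lra.
Qed.

Lemma deep_prob2_le n : deep_prob 2 n <= 2^-1.
Proof.
by case: n => [|n]; [rewrite deep_prob_small ?invr_ge0|rewrite deep_probS branches_prob1_le].
Qed.

(** The central binomial coefficient 'C(2n, n) divided by 4^n, coefficient of
    u^n in (1 - u)^(-1/2). *)
Fixpoint half_binom n : R := if n is m.+1 then half_binom m * (2 * m%:R + 1) / (2 * m%:R + 2) else 1.

Arguments half_binom : simpl never.

Lemma half_binomE n : half_binom n.+1 = half_binom n * (2 * n%:R + 1) / (2 * n%:R + 2).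
Proof. by []. Qed.

Lemma half_binomS n : n.+1%:R * half_binom n.+1 = (n%:R + 2^-1) * half_binom n.
Proof. by rewrite half_binomE -natr1; field; rewrite gt_eqF // ltr_wpDl // mulr_ge0. Qed.

Lemma half_binom_ge0 n : 0 <= half_binom n.
Proof.
elim: n => [|n IH]; first exact: ler01.
have n0 : 0 <= n%:R :> R by [].
by rewrite half_binomE divr_ge0 ?mulr_ge0 //; lra.
Qed.

Lemma half_binom_rec n : n.+1%:R * half_binom n.+1 = 2^-1 * \sum_(i < n.+1) half_binom i.
Proof.
elim: n => [|n IH]; first by rewrite big_ord1 half_binomS; lra.
by rewrite big_ord_recr mulrDr -IH half_binomS /= -!natr1; ring.
Qed.

(** The sum from 0 of half_binom i / (i + 1) telescopes to 2 - 2 half_binom n,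
    as (1 - u)^(-1/2) has the primitive - 2 (1 - u)^(1/2). Leaving out the first
    three terms 1, 1/4 and 1/8 turns 2 into 5/8. *)
Lemma sum_half_binom n :
  \sum_(i < n) half_binom i.+3 / i.+4%:R = 5 / 8 - 2 * half_binom n.+3.
Proof.
elim: n => [|n IH].
  by rewrite big_ord0 !half_binomE /half_binom; field.
have n0 : 0 <= n%:R :> R by [].
have n3 : n.+3%:R = n%:R + 3 :> R by rewrite -addn3 natrD.
have n4 : n.+4%:R = n%:R + 4 :> R by rewrite -addn4 natrD.
rewrite big_ord_recr /= IH (half_binomE n.+3) n3 n4; field.
by apply/andP; split; rewrite gt_eqF //; lra.
Qed.

(** By [deep_prob2_le], H = exp P_2 satisfies H' <= H / (2 (1 - u)), and
    equality holds for (1 - u)^(-1/2). *)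
Lemma branches_prob2_le n : branches_prob 2 n <= half_binom n.
Proof.
elim/ltn_ind: n => -[|n] IH; first by rewrite branches_prob0.
rewrite -(ler_pM2l (ltr0Sn R n)) branches_probS half_binom_rec mulr_sumr.
rewrite [leRHS](reindex_inj rev_ord_inj) /=; apply: ler_sum => i _; rewrite subSS.
apply: ler_pM; rewrite ?deep_prob_ge0 ?branches_prob_ge0 ?deep_prob2_le //.
by apply: IH; rewrite ltnS leq_subr.
Qed.

(** A tree whose childless nodes have depth at least 3 has more than three
    nodes. Without omitting the first terms of the sum, the bound would not be
    below 1, as [branches_sum_le] requires in order to be of use. *)
Lemma deep_sum3_le N : deep_sum N.+3 3 <= 5 / 8.
Proof.
have -> : deep_sum N.+3 3 = \sum_(i < N) deep_prob 3 i.+3 / i.+4%:R.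
  by rewrite /deep_sum !big_ord_recl !deep_prob_small // !mul0r !add0r.
apply: (@le_trans _ _ (\sum_(i < N) half_binom i.+3 / i.+4%:R)).
  apply: ler_sum => i _; rewrite ler_wpM2r ?invr_ge0 //.
  by rewrite (le_trans (deep_prob_le_branches _ _)) // branches_prob2_le.
by rewrite sum_half_binom; have := half_binom_ge0 N.+3; lra.
Qed.

Lemma deep_sum4_le N : deep_sum N.+3 4 <= 3^-1.
Proof.
have := deep_sumS_le N.+2 3; have := branches_sum_le N.+3 3.
have := deep_sum3_le N; have := branches_sum_ge0 N.+3 3.
have := deep_sum_ge0 N.+3 3; nra.
Qed.

Lemma branches_sum_of_deep N j x y : 0 < x -> y = x + 1 ->
  deep_sum N j <= 1 / y -> branches_sum N j <= y / x.
Proof.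
move=> x0 ->; rewrite ler_pdivlMr ?addr_gt0 // => H; rewrite ler_pdivlMr //.
by have := branches_sum_le N j; have := branches_sum_ge0 N j; have := deep_sum_ge0 N j; nra.
Qed.

(** If P <= 1 / (x + 1) then 1 / (1 - P) - 1 <= 1 / x, and dividing this by the
    smallest size i + 6 more than restores the bound at the next level. This
    modest decay makes the product of the sums [branches_sum] telescope. *)
Lemma deep_sum_le_inv N i : deep_sum N.+3 (i + 4) <= 1 / (i%:R + 3).
Proof.
elim: i => [|i IH]; first by rewrite add0r div1r deep_sum4_le.
have i0 : 0 <= i%:R :> R by [].
have B : branches_sum N.+3 (i + 4) <= (i%:R + 3) / (i%:R + 2).
  by apply: branches_sum_of_deep IH; [lra|ring].
have := deep_sumS_le N.+2 (i + 4); rewrite -!natr1 natrD => H.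
rewrite ler_pdivlMr; last lra.
move: B; rewrite ler_pdivlMr => [B|]; last lra.
have := deep_sum_ge0 N.+3 (i + 4).+1; rewrite addSn.
move: H; set X := deep_sum _ _; set Y := branches_sum _ _ in B *.
nra.
Qed.

Lemma branches_sum_le_ratio N i :
  branches_sum N.+3 (i + 4) <= (i%:R + 3) / (i%:R + 2).
Proof.
have i0 : 0 <= i%:R :> R by [].
by apply: branches_sum_of_deep (deep_sum_le_inv N i); [lra|ring].
Qed.

(** Iteration of [deep_sumS_le_mul]: the denominators build up the factorial and
    the ratios of [branches_sum_le_ratio] telescope to a linear factor. *)
Lemma deep_sum_le_fact N i : deep_sum N.+3 (i + 4) <= 20 * (i%:R + 2) / ((i + 5)`!)%:R.
Proof.
elim: i => [|i IH].
  rewrite (le_trans (deep_sum4_le N)) // !add0r add0n.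
  rewrite (_ : (5`!)%:R = 120) //; lra.
have i0 : 0 <= i%:R :> R by [].
rewrite !addSn -(ler_pM2l (ltr0Sn R (i + 5))).
have := deep_sumS_le_mul N.+2 (i + 4).
rewrite (_ : (i + 4).+2 = (i + 5).+1); last by lia.
move=> /le_trans; apply.
rewrite factS natrM.
have F0 : 0 < ((i + 5)`!)%:R :> R by rewrite ltr0n fact_gt0.
apply: (le_trans (ler_pM (deep_sum_ge0 _ _) (branches_sum_ge0 _ _) IH (branches_sum_le_ratio N i))).
rewrite le_eqVlt; apply/orP; left; apply/eqP.
rewrite -(natr1 i); field.
by rewrite !gt_eqF //; lra.
Qed.

Lemma far_meanS0 k d : far_count_mean k d.+1 0 = 0.
Proof. by []. Qed.

(** Write Y and F for the series of the counts at depths d + 1 and d, and H for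
    exp P_m. The cut at the oldest child gives Y' = F H + P_m' Y, whose solution
    is H times the primitive of F. *)
Lemma far_meanS_le k d n (m := (k - d.+2)%N) : far_count_mean k d.+1 n.+1 <=
  \sum_(i < n.+1) far_count_mean k d i / i.+1%:R * branches_prob m (n - i).
Proof.
pose phi i : R := far_count_mean k d i / i.+1%:R.
have phiE i : far_count_mean k d i = i.+1%:R * phi i.
  by rewrite /phi mulrCA divff ?mulr1 // pnatr_eq0.
elim/ltn_ind: n => n IH.
rewrite -(ler_pM2l (ltr0Sn R n)).
have -> : n.+1%:R * far_count_mean k d.+1 n.+1 = \sum_(i < n.+1)
    (far_count_mean k d i * branches_prob m (n - i) + deep_prob m i * far_count_mean k d.+1 (n - i)).
  rewrite /far_count_mean mean_split; apply: eq_bigr => i _.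
  rewrite ![_ * rrt_mean (n - i) _]mulrC -[rrt_mean (n - i) _ * rrt_mean i _ in X in _ = X + _]meanZ.
  rewrite -[rrt_mean (n - i) _ * deep_prob _ _]meanZ -meanD; apply: eq_mean => l _.
  rewrite ![rrt_mean (n - i) _ * _]mulrC -!meanZ -meanD; apply: eq_mean => r _.
  by rewrite /= natrD !natrM.
rewrite big_split /=.
(* Apply the induction hypothesis to the second summand, exchange the sums and
   recognise the recursion of branches_prob in the inner one. *)
have H2 : \sum_(i < n.+1) deep_prob m i * far_count_mean k d.+1 (n - i) <=
    \sum_(l < n) phi l * ((n - l)%:R * branches_prob m (n - l)).
  rewrite big_ord_recr /= subnn far_meanS0 mulr0 addr0.
  apply: (@le_trans _ _ (\sum_(i < n) \sum_(l < n - i) deep_prob m i * (phi l * branches_prob m ((n - i).-1 - l)))).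
    apply: ler_sum => i _; rewrite -mulr_sumr ler_wpM2l ?deep_prob_ge0 //.
    have := ltn_ord i; case E : (n - i)%N => [|u]; first by lia.
    by move=> _; apply: IH; lia.
  rewrite (sum_triangle_swap (fun i l => deep_prob m i * (phi l * branches_prob m ((n - i).-1 - l)))).
  apply: ler_sum => l _; have := ltn_ord l; case E : (n - l)%N => [|u]; first by lia.
  rewrite branches_probS mulr_sumr => _; rewrite le_eqVlt; apply/orP; left; apply/eqP.
  apply: eq_bigr => i _; rewrite mulrCA; congr (_ * (_ * branches_prob _ _)); lia.
rewrite mulr_sumr -/phi.
rewrite (eq_bigr (fun i : 'I_n.+1 => i.+1%:R * phi i * branches_prob m (n - i))); last by move=> i _; rewrite phiE.
apply: (le_trans (lerD (lexx _) H2)).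
(* The term l = n vanishes; adding it gives both sums the same range. *)
rewrite -[X in _ + X]addr0 -[X in _ + (_ + X)](mul0r (phi n * branches_prob m (n - n))).
rewrite (_ : \sum_(l < n) _ + _ = \sum_(l < n.+1) phi l * ((n - l)%:R * branches_prob m (n - l))); last first.
  by rewrite big_ord_recr /= subnn !mul0r mulr0.
rewrite -big_split le_eqVlt; apply/orP; left; apply/eqP; apply: eq_bigr => i _ /=.
have -> : n.+1%:R = i.+1%:R + (n - i)%:R :> R.
  by rewrite -natrD addSn subnKC // -ltnS.
by rewrite -/(phi i); ring.
Qed.

(** A tree counted at depth d + 1 has a path with k + d + 1 edges, so it has at
    least k + d + 2 nodes. *)
Lemma far_sumS_le N k d : (k + d.+2)%:R * far_sum N k d.+1 <=
  far_sum N k d * branches_sum N (k - d.+2).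
Proof.
case: N => [|N]; first by rewrite /far_sum !big_ord0 mulr0 mul0r.
pose a i : R := far_count_mean k d i / i.+1%:R.
have a0 i : 0 <= a i by rewrite divr_ge0 ?far_mean_ge0.
apply: (@le_trans _ _ (\sum_(n < N) far_count_mean k d.+1 n.+1)).
  rewrite /far_sum big_ord_recl far_meanS0 mul0r add0r mulr_sumr.
  apply: ler_sum => i _ /=; rewrite /bump add1n.
  case: (ltnP i.+2 (k + d.+2)) => ik.
    have -> : far_count_mean k d.+1 i.+1 = 0.
      rewrite -[RHS](mean_cst i.+1 0); apply: eq_mean => t tn.
      by rewrite far_count_size // tn.
    by rewrite mul0r mulr0.
  rewrite mulrC -mulrA ler_piMr ?far_mean_ge0 // mulrC ler_pdivrMr ?ltr0Sn //.
  by rewrite mul1r ler_nat.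
apply: (@le_trans _ _ (\sum_(n < N) \sum_(i < n.+1) a i * branches_prob (k - d.+2) (n - i))).
  by apply: ler_sum => i _; exact: far_meanS_le.
apply: (le_trans (sum_convolution_le N a0 (branches_prob_ge0 _))).
apply: ler_pM; rewrite ?sumr_ge0 // ?sum_le_widen // => i *; exact: branches_prob_ge0.
Qed.

Lemma far_sum0 N k : far_sum N k 0 = deep_sum N k.
Proof.
apply: eq_bigr => i _; congr (_ / _); apply: eq_mean => -[a|l r] _ //=.
Qed.

(** Iteration of [far_sumS_le] from [deep_sum_le_fact], the ratios of
    [branches_sum_le_ratio] telescoping again. Along the iteration k is fixed,
    and m decreases as d increases. *)
Lemma far_sum_le N m d (k := (m + d + 5)%N) :
  far_sum N.+3 k d <= 20 * k%:R ^+ 2 / ((m%:R + 2) * ((k + d.+1)`!)%:R).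
Proof.
elim: d m @k => [|d IH] m /=.
  rewrite addn0 far_sum0 (_ : m + 5 = m.+1 + 4)%N; last by lia.
  apply: (le_trans (deep_sum_le_fact N m.+1)).
  rewrite (_ : m.+1 + 4 + 1 = m.+1 + 5)%N; last by lia.
  have m0 : 0 <= m%:R :> R by [].
  have F0 : 0 < ((m.+1 + 5)`!)%:R :> R by rewrite ltr0n fact_gt0.
  rewrite invfM mulrA ler_pM2r ?invr_gt0 // ler_pdivlMr; last lra.
  by rewrite natrD -natr1; nra.
set k := (m + d.+1 + 5)%N.
have -> : (k + d.+2)%N = (k + d.+1).+1 by rewrite addnS.
rewrite -(ler_pM2l (ltr0Sn R (k + d.+1))).
have := far_sumS_le N.+3 k d; rewrite addnS => /le_trans; apply.
have Ek : (m.+1 + d + 5)%N = k by rewrite /k; lia.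
have := IH m.+1; rewrite Ek => IHm.
have := branches_sum_le_ratio N m.
rewrite (_ : m + 4 = k - d.+2)%N; last by rewrite /k; lia.
move=> B.
apply: (le_trans (ler_pM (far_sum_ge0 _ _ _) (branches_sum_ge0 _ _) IHm B)).
have F0 : ((k + d.+1)`!)%:R != 0 :> R by rewrite pnatr_eq0 -lt0n fact_gt0.
have m0 : 0 <= m%:R :> R by [].
rewrite le_eqVlt factS natrM; apply/orP; left; apply/eqP.
rewrite -(natr1 m).
have k1 : 0 <= k%:R :> R by [].
have d0 : 0 <= d%:R :> R by [].
field; rewrite F0 !gt_eqF //; lra.
Qed.

End Decay.

Local Open Scope classical_set_scope.

(** * Existence of the limits and bounds for them *)

Section Expectation.
Variables (R : realType) (n : nat).
Implicit Types X Y : {ffun 'I_n.+1 -> 'I_n.+1} -> R.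

Lemma rrt_expectation_tree (F : tree unit -> R) :
  rrt_expectation (fun p : {ffun 'I_n.+1 -> 'I_n.+1} => F (unlabel (build (fun i => p (inord i)) n))) = rrt_mean n F.
Proof. by rewrite -(mean_attachment F (ltnSn n)). Qed.

(** Only the parent functions with p i < i for all i > 0 have positive
    probability. *)
Lemma ler_rrt_expectation X Y :
  (forall p : {ffun 'I_n.+1 -> 'I_n.+1},
     (forall i : 'I_n.+1, (0 < i)%N -> (p i < i)%N) -> X p <= Y p) ->
  rrt_expectation X <= rrt_expectation Y.
Proof.
move=> H; apply: ler_sum => p _.
case: (pselect (forall i : 'I_n.+1, (0 < i)%N -> (p i < i)%N)) => [V|/existsNP[i]].
  apply: ler_wpM2l; last exact: H.
  apply: prodr_ge0 => i _; rewrite /attach_prob.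
  by case: ifP => // _; case: ifP => // _; rewrite invr_ge0.
move=> /not_implyP[i0 /negP/negbTE pi].
by rewrite /rrt_prob (bigD1 i) //= /attach_prob i0 pi !mul0r.
Qed.

Lemma rrt_expectationD X Y :
  rrt_expectation (fun p => X p + Y p) = rrt_expectation X + rrt_expectation Y.
Proof. by rewrite /rrt_expectation -big_split; apply: eq_bigr => p _; rewrite mulrDr. Qed.

Lemma rrt_expectationB X Y :
  rrt_expectation (fun p => X p - Y p) = rrt_expectation X - rrt_expectation Y.
Proof. by rewrite /rrt_expectation -sumrB; apply: eq_bigr => p _; rewrite mulrBr. Qed.

Lemma rrt_expectationZ X c :
  rrt_expectation (fun p => X p * c) = rrt_expectation X * c.
Proof. by rewrite /rrt_expectation mulr_suml; apply: eq_bigr => p _; rewrite mulrA. Qed.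

Lemma rrt_expectation_cst (c : R) : rrt_expectation (fun _ : {ffun 'I_n.+1 -> 'I_n.+1} => c) = c.
Proof. by rewrite (rrt_expectation_tree (fun=> c)) mean_cst. Qed.

End Expectation.

Section Limits.
Variable R : realType.

(** The tree has n + 1 nodes, as for [rrt_mean]. *)
Definition high_rank_mean k n : R := rrt_expectation (fun p : {ffun 'I_n.+1 -> 'I_n.+1} =>
  (#|[set v | (k <= rank (tree_edge p) v)%N]%SET|)%:R / n.+1%:R).

Lemma rank_meanE k n : rank_mean R k n.+1 = high_rank_mean k n - high_rank_mean k.+1 n.
Proof.
rewrite /rank_mean /high_rank_mean -rrt_expectationB.
apply: eq_bigr => p _; congr (_ * _); rewrite -mulrBl; congr (_ / _).
apply/eqP; rewrite eq_sym subr_eq -natrD eqr_nat /rank_count; apply/eqP.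
rewrite -cardsUI [X in (_ + X)%N](_ : _ = 0%N) ?addn0.
  by congr #|pred_of_set _|; apply/setP => v; rewrite !inE leq_eqVlt eq_sym.
apply/eqP; rewrite cards_eq0; apply/eqP/setP => v; rewrite !inE.
by apply/negP => /andP[/eqP->]; rewrite ltnn.
Qed.

Definition fringe_density (f : tree unit -> nat) n : R :=
  \sum_(m < n) rrt_mean m (fun t => (f t)%:R) / (m.+1%:R * m.+2%:R).

Lemma rrt_expectation_fringe n (f : tree unit -> nat) :
  rrt_expectation (fun p : {ffun 'I_n.+1 -> 'I_n.+1} =>
    (fringe_sum (fun t => f (unlabel t)) (build (fun i => p (inord i)) n))%:R / n.+1%:R)
  = fringe_density f n :> R.
Proof.
rewrite rrt_expectationZ /fringe_density.
under eq_fun do rewrite -(fringe_sum_unlabel f).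
rewrite (rrt_expectation_tree _ (fun t => (fringe_sum f t)%:R)) mean_fringe_sum.
by rewrite mulrC mulKf // pnatr_eq0.
Qed.

Definition shallow_mean d n : R := rrt_mean n (fun t => (depth_count t d)%:R) / n.+1%:R.

Lemma high_rank_mean_ge k n : (0 < n)%N -> (0 < k <= n.+1)%N ->
  fringe_density (fun t => far_count k t k.-1) n <= high_rank_mean k n.
Proof.
move=> n0 kn; rewrite -rrt_expectation_fringe; apply: ler_rrt_expectation => p V.
apply: ler_wpM2r; first by rewrite invr_ge0.
rewrite ler_nat; apply: leq_trans (fringe_far_le_card n0 V kn).
by rewrite (eq_fringe_sum _ (fun t => far_count_unlabel k t k.-1)).
Qed.

Lemma high_rank_mean_le k d n : (0 < n)%N -> (k <= n.+1)%N ->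
  high_rank_mean k n <= fringe_density (fun t => far_count k t d) n + shallow_mean d n.
Proof.
move=> n0 kn; rewrite -rrt_expectation_fringe.
rewrite /shallow_mean -rrt_expectation_tree -rrt_expectationZ.
rewrite -rrt_expectationD; apply: ler_rrt_expectation => p V; rewrite -mulrDl.
apply: ler_wpM2r; first by rewrite invr_ge0.
rewrite -natrD ler_nat; apply: leq_trans (card_le_fringe_far n0 V d kn) _.
by rewrite (eq_fringe_sum _ (fun t => far_count_unlabel k t d)) depth_count_unlabel.
Qed.

Lemma rank_mean_ge k n : (0 < k <= n)%N ->
  fringe_density (fun t => is_path k.*2.-1 t) n <= rank_mean R k n.+1.
Proof.
move=> /andP[k0 kn]; have n0 : (0 < n)%N by exact: leq_trans kn.
rewrite -rrt_expectation_fringe; apply: ler_rrt_expectation => p V.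
apply: ler_wpM2r; first by rewrite invr_ge0.
rewrite ler_nat; apply: leq_trans (fringe_path_le_card n0 V _); last by rewrite k0.
by rewrite (eq_fringe_sum _ (fun t => congr1 nat_of_bool (is_path_unlabel k.*2.-1 t))).
Qed.

Lemma high_rank_mean_le1 k n : high_rank_mean k n <= 1.
Proof.
rewrite -(rrt_expectation_cst n 1); apply: ler_rrt_expectation => p _.
by rewrite ler_pdivrMr ?ltr0Sn // mul1r ler_nat -[X in (_ <= X)%N]card_ord max_card.
Qed.

Lemma fringe_density_ndecr f : nondecreasing_seq (fringe_density f).
Proof.
apply/nondecreasing_seqP => n; rewrite /fringe_density big_ord_recr /= lerDl.
by rewrite divr_ge0 ?mulr_ge0 // mean_ge0.
Qed.

(** The probability that a new node has depth at most d is the mean proportion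
    of nodes of depth less than d. By induction on d it tends to 0, and by Cesaro
    so does the mean proportion of nodes of depth at most d. *)
Lemma shallow_mean_cvg d : shallow_mean d n @[n --> \oo] --> (0 : R).
Proof.
have step d' : (if d' is e.+1 then shallow_mean e n @[n --> \oo] --> (0 : R) else True) ->
    shallow_mean d' n @[n --> \oo] --> (0 : R).
  move=> H.
  pose inc k : R := (if d' is e.+1 then shallow_mean e k else 0).
  (* The increments of the count, started with the single node of the first
     tree, so that their arithmetic average of order n has the n + 1 terms needed. *)
  pose w k : R := if k is k'.+1 then inc k' else 1.
  have incE k : inc k = (if d' is e.+1 then rrt_mean k (fun t => (depth_count t e)%:R) else 0) / k.+1%:R.
    by rewrite /inc; case: (d') => //; rewrite mul0r.
  have sumw n : rrt_mean n (fun t => (depth_count t d')%:R) = \sum_(k < n.+1) w k.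
    elim: n => [|n IH]; first by rewrite big_ord1.
    by rewrite mean_depth_countS big_ord_recr -IH [w _]incE.
  have w0 : w n @[n --> \oo] --> (0 : R).
    rewrite -cvg_shiftS /= /inc; case: (d') H => // _; exact: cvg_cst.
  have := cesaro w0; apply: cvg_trans; apply: near_eq_cvg; near=> n.
  by rewrite /arithmetic_mean /shallow_mean /= sumw mulrC /series /= big_mkord.
elim: d => [|d IH]; exact: step.
Unshelve. all: by end_near. Qed.

Definition high_rank_limit k : R := limn (high_rank_mean k).

(** The statistics of fringe subtrees at ancestor distance k - 1 bound the mean
    from below and, up to the nodes of small depth, from above; their density is
    monotone and bounded. *)
Lemma high_rank_cvg k : (0 < k)%N -> high_rank_mean k n @[n --> \oo] --> high_rank_limit k.
Proof.
move=> k0; pose u := fringe_density (fun t => far_count k t k.-1).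
have uk n : u n <= high_rank_mean k (n + k).
  have h : (k <= (n + k).+1)%N by rewrite leqW ?leq_addl.
  apply: (le_trans (fringe_density_ndecr _ (leq_addr k n))).
  by apply: high_rank_mean_ge; rewrite ?addn_gt0 k0 ?orbT ?h.
have cu : cvgn u.
  apply: nondecreasing_is_cvgn; first exact: fringe_density_ndecr.
  by exists 1 => _ [n _ <-]; apply: le_trans (uk n) (high_rank_mean_le1 _ _).
apply: (cvgP (limn u)).
apply: (@squeeze_cvgr _ _ _ _ u (fun n => u n + shallow_mean k.-1 n)).
- near=> n; have kn : (k <= n)%N by near: n; exact: nbhs_infty_ge.
  have n0 : (0 < n)%N by exact: leq_trans kn.
  by rewrite high_rank_mean_ge ?high_rank_mean_le ?k0 ?leqW.
- exact: cu.
- rewrite -[limn u]addr0; apply: cvgD => //; exact: shallow_mean_cvg.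
Unshelve. all: by end_near. Qed.

Lemma high_rank_limit_ge0 k : (0 < k)%N -> 0 <= high_rank_limit k.
Proof.
move=> k0; apply: limr_ge; first by apply: cvgP; exact: high_rank_cvg.
near=> n; rewrite -(rrt_expectation_cst n 0); apply: ler_rrt_expectation => p _.
by rewrite divr_ge0.
Unshelve. all: by end_near. Qed.

Lemma rank_mean_cvg k : (0 < k)%N ->
  rank_mean R k n @[n --> \oo] --> high_rank_limit k - high_rank_limit k.+1.
Proof.
move=> k0; rewrite -cvg_shiftS /=.
under eq_fun do rewrite rank_meanE.
by apply: cvgB; apply: high_rank_cvg.
Qed.

Lemma rank_limit_ge k : (0 < k)%N -> ((k.*2.+1)`!)%:R^-1 <= rank_limit R k.
Proof.
move=> k0; apply: limr_ge; first by apply: cvgP; exact: rank_mean_cvg.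
near=> n0; have kn0 : (k.*2.+1 < n0)%N by near: n0; exact: nbhs_infty_gt.
have [n En kn'] : exists2 n, n0 = n.+1 & (k.*2.-1 < n)%N by exists n0.-1; lia.
rewrite En; apply: le_trans (rank_mean_ge _); last by rewrite k0 /=; lia.
rewrite /fringe_density (bigD1 (Ordinal kn')) //= mean_path.
apply: ler_wpDr.
  by apply: sumr_ge0 => m _; rewrite divr_ge0 ?mulr_ge0 // mean_ge0.
rewrite -[in k.*2.+1](prednK (n := k.*2)) ?double_gt0 //.
by rewrite -invfM -!natrM !factS mulnA mulnC (mulnC _.+2).
Unshelve. all: by end_near. Qed.

(** The ancestor number k - 5 is the last one for which only the series P_j with
    j >= 4 occur. *)
Lemma rank_limit_le k : (5 <= k)%N ->
  rank_limit R k <= 10 * k%:R ^+ 2 / ((k.*2 - 4)`!)%:R.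
Proof.
move=> k5; have k0 : (0 < k)%N by lia.
have -> : rank_limit R k = high_rank_limit k - high_rank_limit k.+1.
  by apply/cvg_lim => //; exact: rank_mean_cvg.
apply: (@le_trans _ _ (high_rank_limit k)).
  by rewrite lerBlDr lerDl high_rank_limit_ge0.
set B := (leRHS).
have lim : (B + shallow_mean (k - 5) n) @[n --> \oo] --> B.
  rewrite -[X in _ --> X]addr0; apply: cvgD; [exact: cvg_cst|exact: shallow_mean_cvg].
have := cvg_lim (@Rhausdorff R) lim => <-.
apply: ler_lim; [by apply: cvgP; exact: high_rank_cvg|by apply: cvgP; exact: lim|].
near=> n; have kn : (k < n)%N by near: n; exact: nbhs_infty_gt.
have n3 : (2 < n)%N by lia.
apply: le_trans (high_rank_mean_le (k - 5) _ _) _; [lia|lia|].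
rewrite lerD2r.
apply: (@le_trans _ _ (far_sum R n k (k - 5))).
  apply: ler_sum => m _; rewrite invfM mulrA ler_piMr //.
    by rewrite divr_ge0 // mean_ge0.
  by rewrite invf_le1 ?ltr0Sn // ler1n.
have := far_sum_le R (n - 3) 0 (k - 5).
rewrite (_ : (n - 3).+3 = n); last lia.
rewrite add0n subnK //; move=> /le_trans; apply.
rewrite (_ : (k + (k - 5).+1)%N = k.*2 - 4)%N; last by lia.
rewrite /B add0r invfM mulrA ler_pM2r ?invr_gt0 ?ltr0n ?fact_gt0 //.
by lra.
Unshelve. all: by end_near. Qed.

End Limits.

(** * Comparison with factorials on the logarithmic scale *)

Section Factorial.
Variable R : realType.
Implicit Types (n k : nat).

Lemma ln_ratio_le n : n.+1%:R * (ln n.+2%:R - ln n.+1%:R) <= 1 :> R.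
Proof.
have n0 : 0 < n.+1%:R :> R by rewrite ltr0Sn.
rewrite -ln_div ?posrE ?ltr0Sn // mulrC -ler_pdivlMr // div1r.
have -> : n.+2%:R / n.+1%:R = 1 + n.+1%:R^-1 :> R.
  by rewrite -(natr1 n.+1) mulrDl divff ?gt_eqF // mul1r.
by apply: le_ln1Dx; apply: lt_trans (_ : 0 < _); rewrite ?ltrN10 ?invr_gt0.
Qed.

Lemma ln_ratio_ge n : 1 <= n.+2%:R * (ln n.+2%:R - ln n.+1%:R) :> R.
Proof.
have n0 : 0 < n.+2%:R :> R by rewrite ltr0Sn.
have : ln (1 + (- n.+2%:R^-1)) <= - n.+2%:R^-1 :> R.
  by apply: le_ln1Dx; rewrite ltrN2 invf_lt1 // ltr1n.
have -> : 1 + (- n.+2%:R^-1) = n.+1%:R / n.+2%:R :> R.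
  by rewrite -[n.+1%:R](addrK 1) natr1 mulrBl divff ?gt_eqF // mul1r.
rewrite ln_div ?posrE ?ltr0Sn // => H.
by rewrite mulrC -ler_pdivrMr // div1r -lerN2 opprB.
Qed.

Lemma ln_fact_ge n : n.+1%:R * ln n.+1%:R - n.+1%:R <= ln (n.+1`!)%:R :> R.
Proof.
elim: n => [|n IH]; first by rewrite ln1; lra.
rewrite factS natrM lnM ?posrE ?ltr0Sn ?ltr0n ?fact_gt0 //.
by have := ln_ratio_le n; rewrite -(natr1 n.+1); lra.
Qed.

Lemma ln_fact_le n :
  ln (n.+1`!)%:R <= (n.+1%:R + 1) * ln n.+1%:R - n.+1%:R + 1 :> R.
Proof.
elim: n => [|n IH]; first by rewrite ln1; lra.
rewrite factS natrM lnM ?posrE ?ltr0Sn ?ltr0n ?fact_gt0 //.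
by have := ln_ratio_ge n; rewrite -(natr1 n.+1); lra.
Qed.

(** Each of the j factors removed from m! is at most m. *)
Lemma ln_fact_sub_ge m j : (j < m)%N ->
  ln (m`!)%:R - j%:R * ln m%:R <= ln ((m - j)`!)%:R :> R.
Proof.
elim: j => [|j IH] jm; first by rewrite subn0; lra.
have := IH (ltnW jm).
have -> : (m - j = (m - j.+1).+1)%N by lia.
rewrite factS natrM lnM ?posrE ?ltr0Sn ?ltr0n ?fact_gt0 //.
have : ln (m - j.+1).+1%:R <= ln m%:R :> R.
  by rewrite ler_ln ?posrE ?ltr0n ?ler_nat //; lia.
rewrite -(natr1 j); lra.
Qed.

Lemma ln_ge1 k : (8 <= k)%N -> 1 <= ln k%:R :> R.
Proof.
move=> k8; have l2 : 2^-1 <= ln 2 :> R.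
  have := @ln_ratio_ge 0; rewrite ln1; lra.
have : ln 8 <= ln k%:R :> R by rewrite ler_ln ?posrE ?ltr0n ?ler_nat //; lia.
rewrite (_ : 8 = 2 ^+ 3) ?lnXn //; last by rewrite -natrX.
by lra.
Qed.

(** The main terms add up to 2k ln (2k) - 2k, which is ln (2k)! up to O(ln k). *)
Lemma log_rank_limit k : (10 <= k)%N ->
  `| ln (rank_limit R k) + 2 * k%:R * ln k%:R - 2 * (1 - ln 2) * k%:R | <= 20 * ln k%:R.
Proof.
move=> k10; have k0 : (0 < k)%N by lia.
have kR : 0 < k%:R :> R by rewrite ltr0n.
have l1 := @ln_ge1 k ltac:(lia).
have l10 : ln 10 <= ln k%:R :> R by rewrite ler_ln ?posrE ?ler_nat.
have E2 : ln k.*2%:R = ln 2 + ln k%:R :> R.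
  by rewrite -mul2n natrM lnM ?posrE.
have l2 : ln 2 <= ln k%:R :> R by rewrite ler_ln ?posrE ?ler_nat //; lia.
have l22 : ln k.*2.+1%:R <= 2 * ln k%:R :> R.
  have -> : 2 * ln k%:R = ln (k%:R ^+ 2) :> R by rewrite lnXn // mulr_natl.
  rewrite ler_ln ?posrE ?ltr0n ?exprn_gt0 // -natrX ler_nat; nia.
have P : 0 < (k.*2.+1)`!%:R^-1 :> R by rewrite invr_gt0 ltr0n fact_gt0.
have rpos := lt_le_trans P (rank_limit_ge R k0).
have lo : - ln (k.*2.+1)`!%:R <= ln (rank_limit R k).
  by rewrite -lnV ?posrE ?ltr0n ?fact_gt0 // ler_ln ?posrE // rank_limit_ge.
have F4 : 0 < ((k.*2 - 4)`!)%:R :> R by rewrite ltr0n fact_gt0.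
have hi : ln (rank_limit R k) <= ln 10 + 2 * ln k%:R - ln ((k.*2 - 4)`!)%:R.
  have -> : 2 * ln k%:R = ln (k%:R ^+ 2) :> R by rewrite lnXn // mulr_natl.
  rewrite -lnM ?posrE ?exprn_gt0 // -ln_div ?posrE ?mulr_gt0 ?exprn_gt0 //.
  by rewrite ler_ln ?posrE ?divr_gt0 ?mulr_gt0 ?exprn_gt0 // rank_limit_le //; lia.
have D : k.*2%:R = 2 * k%:R :> R by rewrite -mul2n natrM.
have Ek : k.*2.-1.+1 = k.*2 by lia.
have := ln_fact_le k.*2.-1; have := ln_fact_ge k.*2.-1; rewrite Ek => fge fle.
have := @ln_fact_sub_ge k.*2 4 ltac:(lia) => sub.
move: lo; rewrite factS natrM lnM ?posrE ?ltr0Sn ?ltr0n ?fact_gt0 // => lo.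
move: fge fle sub; rewrite E2 D => fge fle sub.
rewrite ler_norml; apply/andP; split; lra.
Qed.
End Factorial.

Theorem theorem3 (R : realType) :
  exists h : nat -> R,
    h =O_\oo (fun k : nat => ln k%:R : R) /\
    \forall k \near \oo,
      rank_limit R k =
        expR (- 2 * k%:R * ln k%:R + 2 * (1 - ln 2) * k%:R + h k).
Proof.
exists (fun k => ln (rank_limit R k) + 2 * k%:R * ln k%:R - 2 * (1 - ln 2) * k%:R); split.
  apply/eqO_exP; exists 20; first by rewrite ltr0n.
  near=> k.
  have k10 : (10 <= k)%N by near: k; exact: nbhs_infty_ge.
  rewrite [X in _ <= _ * X]ger0_norm; first exact: log_rank_limit.
  by rewrite ln_ge0 // ler1n; lia.
near=> k; have k0 : (0 < k)%N by near: k; exact: nbhs_infty_gt.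
set e := (X in expR X).
have -> : e = ln (rank_limit R k) by rewrite /e; ring.
rewrite lnK // posrE; apply: lt_le_trans (rank_limit_ge R k0).
by rewrite invr_gt0 ltr0n fact_gt0.
Unshelve. all: by end_near. Qed.
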